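(* Let $p\in[2,\infty)$ and $\alpha\in(1-\frac2p,1]$. Let $\gamma\in C^{1,\alpha}(\mathbb{R}/2\pi\mathbb{Z},\mathbb{R}^3)$ be simple and regular and let $\Phi\in C^{1,\alpha}(\mathbb{R}/2\pi\mathbb{Z},\mathbb{R}^3)$. Then the first variation of integral Menger curvature at $\gamma$ in direction $\Phi$, $$\delta\mathscr{M}_p(\gamma,\Phi)=\frac{d}{d\tau}\Big|_{\tau=0}\mathscr{M}_p(\gamma+\tau\Phi),$$ exists.
   Context: Functions on $\mathbb{R}/2\pi\mathbb{Z}$ are $2\pi$-periodic functions on $\mathbb{R}$. $C^{1,\alpha}(\mathbb{R}/2\pi\mathbb{Z},\mathbb{R}^3)$ is the space of $C^1$ periodic functions whose derivative is Hölder continuous with exponent $\alpha$. A closed curve $\gamma$ is simple if $\gamma(s)\ne\gamma(t)$ whenever $s-t\notin 2\pi\mathbb{Z}$; a $C^1$ curve is regular if $\gamma'(x)\ne0$ for all $x$. For a simple closed curve $\gamma$, $$c_\gamma(s,t,\sigma):=\frac{2\,|(\gamma(t)-\gamma(s))\wedge(\gamma(\sigma)-\gamma(s))|}{|\gamma(t)-\gamma(s)|\,|\gamma(s)-\gamma(\sigma)|\,|\gamma(\sigma)-\gamma(t)|},$$ with $\wedge$ the cross product in $\mathbb{R}^3$; it is defined off the null set where two of the arguments differ by an element of $2\pi\mathbb{Z}$. For a simple regular closed curve, $$\mathscr{M}_p(\gamma):=\int_0^{2\pi}\int_0^{2\pi}\int_0^{2\pi}c_\gamma(s,t,\sigma)^p\,|\gamma'(s)|\,|\gamma'(t)|\,|\gamma'(\sigma)|\,d\sigma\,dt\,ds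 .$$ For $\gamma,\Phi$ as in the claim, $\gamma+\tau\Phi$ is simple and regular for all sufficiently small $|\tau|$. *)

(* Defs.v *)
From HB Require Import structures.
From mathcomp Require Import all_boot all_order all_algebra.
From mathcomp Require Import all_classical all_reals all_analysis.

Set Implicit Arguments.
Unset Strict Implicit.
Unset Printing Implicit Defensive.
Import Order.TTheory GRing.Theory Num.Theory.
Import numFieldNormedType.Exports.

Local Open Scope classical_set_scope.
Local Open Scope ring_scope.

(* The canonical norm `|v| on 'rV[R]_3 is the sup norm, hence this one. *)
Definition enorm3 (R : realType) (v : 'rV[R]_3) : R :=
  Num.sqrt (\sum_(i < 3) v 0 i ^+ 2).

Definition cross3 (R : realType) (u v : 'rV[R]_3) : 'rV[R]_3 :=
  let x := @Ordinal 3 0 isT in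
  let y := @Ordinal 3 1 isT in
  let z := @Ordinal 3 2 isT in
  \row_(i < 3) [:: u 0 y * v 0 z - u 0 z * v 0 y;
                   u 0 z * v 0 x - u 0 x * v 0 z;
                   u 0 x * v 0 y - u 0 y * v 0 x]`_i.

Definition periodic2pi (R : realType) (f : R -> 'rV[R]_3) : Prop :=
  forall x : R, f (x + 2 * pi) = f x.

(* For a periodic derivative, the Hoelder bound with respect to the distance
   of the real line is the same as with respect to that of the circle. *)
Definition C1alpha (R : realType) (alpha : R) (f : R -> 'rV[R]_3) : Prop :=
  [/\ periodic2pi f,
      forall x : R, derivable f x 1,
      continuous (derive1 f) &
      exists K : R, forall x y : R,
        enorm3 (derive1 f x - derive1 f y) <= K * `|x - y| `^ alpha].

Definition simple_closed (R : realType) (f : R -> 'rV[R]_3) : Prop :=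
  forall s t : R,
    (forall k : int, s - t <> k%:~R * (2 * pi)) -> f s <> f t.

Definition regular_curve (R : realType) (f : R -> 'rV[R]_3) : Prop :=
  forall x : R, derive1 f x <> 0.

(* Value 0 where two of the points coincide (x / 0 = 0); for a simple closed
   curve this only concerns a null set of arguments. *)
Definition menger_curv (R : realType) (f : R -> 'rV[R]_3) (s t sigma : R) : R :=
  2 * enorm3 (cross3 (f t - f s) (f sigma - f s)) /
  (enorm3 (f t - f s) * enorm3 (f s - f sigma) * enorm3 (f sigma - f t)).

Definition menger_energy (R : realType) (p : R) (f : R -> 'rV[R]_3) : \bar R :=
  (\int[lebesgue_measure]_(s in `[0%R, (2 * pi)%R])
   \int[lebesgue_measure]_(t in `[0%R, (2 * pi)%R])
   \int[lebesgue_measure]_(sigma in `[0%R, (2 * pi)%R])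
     (menger_curv f s t sigma `^ p *
      enorm3 (derive1 f s) * enorm3 (derive1 f t) * enorm3 (derive1 f sigma))%:E)%E.

(* The energy is [0, +oo]-valued: differentiability at 0 of
   tau |-> F tau includes that F is finite near 0, since [fine] would
   otherwise turn +oo into 0. *)
Definition ederivable_at0 (R : realType) (F : R -> \bar R) : Prop :=
  (\forall tau \near (0 : R), F tau \is a fin_num) /\
  derivable (fun tau : R => fine (F tau)) 0 1.

(* Main.v *)
Require Import Defs.
From HB Require Import structures.
From mathcomp Require Import all_boot all_order all_algebra.
From mathcomp Require Import all_classical all_reals all_analysis.
From mathcomp Require Import measurable_realfun.
From mathcomp Require Import ring lra.
Import Order.TTheory GRing.Theory Num.Theory.
Import numFieldNormedType.Exports.
Local Open Scope classical_set_scope.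
Local Open Scope ring_scope.

Set Implicit Arguments.
Unset Strict Implicit.
Unset Printing Implicit Defensive.

(** The derivative is taken under the integral sign by dominated convergence.

    Let d be the distance on the circle and m the largest of the three distances
    between s, t and u.  The coordinates of the cross product in the numerator of
    the curvature are the minors (f t - f s)(g u - g s) - (g t - g s)(f u - f s);
    up to sign they are symmetric in s, t, u.  Taking as base point the vertex
    opposite to the longest side, the mean value theorem and the Hoelder bound on
    the derivatives show that each minor is at most C d(s,t) d(s,u) d(t,u)
    m^(alpha - 1).  Since gamma is bi-Lipschitz for d, and remains so uniformly
    under small perturbations, dividing every chord and every minor by its natural
    scale leaves functions of tau that are uniformly bounded, uniformly Lipschitz
    at 0, and bounded away from 0 where they are raised to a negative power.
    Therefore the integrand and its difference quotients are at most
    C m^((alpha - 1) p) <= C d(s,t)^(-b) d(t,u)^(-b), where b = (1 - alpha) p / 2,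
    and this is integrable because alpha > 1 - 2 / p means b < 1.  Pointwise, the
    integrand is differentiable at tau = 0 even where the curvature vanishes,
    because the squared area is a sum of squares and p / 2 >= 1. *)

(** * Lipschitz bounds for real powers *)

Section powR_lipschitz.
Context {R : realType}.
Implicit Types (a b r x y z M : R).

(** The power is monotone in its base, in a direction given by the sign of [r]; the sum of the two
    endpoint values covers both directions. *)
Lemma le_powR_monotone a b x r : 0 < a -> a <= x <= b -> x `^ r <= a `^ r + b `^ r.
Proof.
move=> a0 /andP[ax xb].
have [r0|r0] := leP 0 r.
  apply: ler_wpDl; first exact: powR_ge0.
  by apply: ge0_ler_powR => //; rewrite nnegrE; lra.
apply: ler_wpDr; first exact: powR_ge0.
have x0 : 0 < x by lra.
rewrite -(opprK r) !(powRN _ (- r)) lef_pV2 ?posrE ?powR_gt0//.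
by apply: ge0_ler_powR; rewrite ?nnegrE; lra.
Qed.

(** Mean value theorem: away from 0 the derivative of the power is bounded for every real
    exponent. *)
Lemma powR_lipschitz_gt0 a b r : 0 < a ->
  exists C, forall x y, a <= x <= b -> a <= y <= b ->
    `|x `^ r - y `^ r| <= C * `|x - y|.
Proof.
move=> a0; pose C := `|r| * (a `^ (r - 1) + b `^ (r - 1)).
suff H x y : a <= x <= b -> a <= y <= b -> x <= y ->
    `|x `^ r - y `^ r| <= C * `|x - y|.
  exists C => x y xab yab; have [xy|/ltW yx] := leP x y; first exact: H.
  by rewrite distrC (distrC x); exact: H.
move=> xab yab xy.
have der z : z \in `[x, y] -> is_derive z 1 (@powR R ^~ r) (r * z `^ (r - 1)).
  by rewrite in_itv/= => zxy; apply: is_derive1_powR; lra.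
have [z zxy] := @MVT_segment R (@powR R ^~ r) (fun z => r * z `^ (r - 1)) x y xy
  (fun z zi => der z (subset_itv_oo_cc zi))
  (derivable_within_continuous (fun z zi => @ex_derive _ _ _ _ _ _ _ (der z zi))).
rewrite distrC => ->; rewrite normrM distrC ler_wpM2r// normrM ler_wpM2l//.
rewrite ger0_norm ?powR_ge0//; apply: le_powR_monotone => //.
by move: zxy; rewrite in_itv/=; lra.
Qed.

Lemma powR_le_mul b x r : 1 <= r -> 0 <= x <= b -> x `^ r <= b `^ (r - 1) * x.
Proof.
move=> r1 /andP[x0 xb]; rewrite -mulr_powRB1//; last lra.
rewrite mulrC ler_wpM2r//; apply: ge0_ler_powR; rewrite ?nnegrE; lra.
Qed.

(** An exponent of at least 1 keeps the derivative bounded down to 0, so the base may vanish here.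
    This is needed for the area, which is 0 on collinear triples. *)
Lemma powR_lipschitz_ge1 b r : 1 <= r ->
  exists C, forall x y, 0 <= x <= b -> 0 <= y <= b ->
    `|x `^ r - y `^ r| <= C * `|x - y|.
Proof.
move=> r1; pose C := r * b `^ (r - 1).
suff H x y : 0 <= x <= b -> 0 <= y <= b -> x <= y ->
    `|x `^ r - y `^ r| <= C * `|x - y|.
  exists C => x y xab yab; have [xy|/ltW yx] := leP x y; first exact: H.
  by rewrite distrC (distrC x); exact: H.
move=> xab yab xy.
(* The derivative formula for powers asks for a positive base, so the endpoint 0 is treated
   apart. *)
have [x0|x0] := eqVneq x 0.
  rewrite x0 powR0 ?sub0r ?normrN; last by rewrite gt_eqF//; lra.
  rewrite !ger0_norm ?powR_ge0//; last lra.
  apply: (le_trans (@powR_le_mul b y r r1 yab)).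
  rewrite ler_wpM2r//; first lra.
  by rewrite ler_peMl ?powR_ge0.
have {}x0 : 0 < x by rewrite lt0r x0; lra.
have der z : z \in `[x, y] -> is_derive z 1 (@powR R ^~ r) (r * z `^ (r - 1)).
  by rewrite in_itv/= => zxy; apply: is_derive1_powR; lra.
have [z zxy] := @MVT_segment R (@powR R ^~ r) (fun z => r * z `^ (r - 1)) x y xy
  (fun z zi => der z (subset_itv_oo_cc zi))
  (derivable_within_continuous (fun z zi => @ex_derive _ _ _ _ _ _ _ (der z zi))).
rewrite distrC => ->; rewrite normrM distrC ler_wpM2r// normrM.
rewrite ger0_norm; last lra.
apply: ler_wpM2l; first lra.
rewrite ger0_norm ?powR_ge0//; move: zxy; rewrite in_itv/= => zxy.
by apply: ge0_ler_powR; rewrite ?nnegrE; lra.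
Qed.

End powR_lipschitz.

(** * Families of functions bounded and Lipschitz at 0, uniformly in the index *)

Section uniformly_lipschitz_at0.
Context {R : realType} {I : Type} (A : set I) (e : R).
Implicit Types (h k : I -> R -> R) (u v : I -> R).

(** Boundedness and the Lipschitz bound at the base point 0 are what the domination of difference
    quotients requires, and together they survive sums, products and suitable powers. *)
Definition unif_lip0 h := exists M, forall i tau, A i -> `|tau| <= e ->
  `|h i tau| <= M /\ `|h i tau - h i 0| <= M * `|tau|.

Lemma unif_lip0_ge0 h : unif_lip0 h -> exists2 M, 0 <= M & forall i tau,
  A i -> `|tau| <= e -> `|h i tau| <= M /\ `|h i tau - h i 0| <= M * `|tau|.
Proof.
move=> [M hM]; exists `|M| => // i tau Ai te.
have [h1 h2] := hM i tau Ai te.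
split; first exact: le_trans h1 (ler_norm _).
by apply: le_trans h2 _; rewrite ler_wpM2r// ler_norm.
Qed.

Lemma eq_unif_lip0 h k :
  (forall i tau, A i -> h i tau = k i tau) -> unif_lip0 h -> unif_lip0 k.
Proof.
move=> hk [M hM]; exists M => i tau Ai te.
by have := hM i tau Ai te; rewrite !hk.
Qed.

Lemma unif_lip0_affine u v M : (forall i, A i -> `|u i| <= M) ->
  (forall i, A i -> `|v i| <= M) -> unif_lip0 (fun i tau => u i + tau * v i).
Proof.
move=> hu hv; exists (M + `|M| + e * M) => i tau Ai te.
have M0 : 0 <= M by apply: le_trans (hu _ Ai).
have e0 : 0 <= e by apply: le_trans te.
rewrite (ger0_norm M0) mul0r addr0 [u i + _ - _]addrAC subrr add0r; split.
  apply: (le_trans (ler_normD _ _)); rewrite normrM.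
  apply: lerD; first by apply: (le_trans (hu _ Ai)); rewrite lerDl.
  by apply: ler_pM => //; exact: hv.
rewrite normrM mulrC ler_wpM2r//; apply: (le_trans (hv _ Ai)).
by rewrite -addrA lerDl addr_ge0// mulr_ge0.
Qed.

Lemma unif_lip0D h k : unif_lip0 h -> unif_lip0 k ->
  unif_lip0 (fun i tau => h i tau + k i tau).
Proof.
move=> [M hM] [N kN]; exists (M + N) => i tau Ai te.
have [h1 h2] := hM i tau Ai te; have [k1 k2] := kN i tau Ai te.
split; first by apply: (le_trans (ler_normD _ _)); exact: lerD.
by rewrite opprD addrACA mulrDl; apply: (le_trans (ler_normD _ _)); exact: lerD.
Qed.

Lemma unif_lip0M h k : unif_lip0 h -> unif_lip0 k ->
  unif_lip0 (fun i tau => h i tau * k i tau).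
Proof.
move=> /unif_lip0_ge0[M M0 hM] /unif_lip0_ge0[N N0 kN].
exists (M * N + M * N) => i tau Ai te.
have [h1 h2] := hM i tau Ai te; have [k1 k2] := kN i tau Ai te.
have z0 : `|0 : R| <= e by rewrite normr0; exact: le_trans (normr_ge0 _) te.
have [k3 _] := kN i 0 Ai z0.
split.
  by rewrite normrM; apply: (@le_trans _ _ (M * N));
    [exact: ler_pM|rewrite lerDl mulr_ge0].
have -> : h i tau * k i tau - h i 0 * k i 0 =
  h i tau * (k i tau - k i 0) + (h i tau - h i 0) * k i 0 by ring.
apply: (le_trans (ler_normD _ _)); rewrite !normrM mulrDl; apply: lerD.
  by rewrite -mulrA; exact: ler_pM.
by rewrite mulrAC; exact: ler_pM.
Qed.

Lemma unif_lip0_sqr h : unif_lip0 h -> unif_lip0 (fun i tau => h i tau ^+ 2).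
Proof. by move=> hh; apply: unif_lip0M. Qed.

Let unif_lip0_comp (P : set R) (phi : R -> R) h :
  (forall M, exists C, forall x y, P x -> P y -> `|x| <= M -> `|y| <= M ->
    `|phi x - phi y| <= C * `|x - y|) ->
  (forall i tau, A i -> `|tau| <= e -> P (h i tau)) ->
  unif_lip0 h -> unif_lip0 (fun i tau => phi (h i tau)).
Proof.
move=> lipphi hP /unif_lip0_ge0[M M0 hM].
have [C phiC] := lipphi M.
(* A Lipschitz bound alone does not bound [phi]: values are compared with [phi] at the single
   reference point [h i0 0]. The cases without an index or with [e < 0] are settled first. *)
have [[i0 Ai0]|noA] := pselect (exists i, A i); last first.
  by exists 0 => i tau Ai; exfalso; apply: noA; exists i.
have [e0|e0] := leP 0 e; last first.
  by exists 0 => i tau _ te; exfalso; move: (le_trans (normr_ge0 _) te); lra.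
have z0 : `|0 : R| <= e by rewrite normr0.
have C' x y : P x -> P y -> `|x| <= M -> `|y| <= M ->
    `|phi x - phi y| <= `|C| * `|x - y|.
  move=> Px Py xM yM; apply: (le_trans (phiC _ _ Px Py xM yM)).
  by rewrite ler_wpM2r// ler_norm.
pose x0 := h i0 0.
exists (`|C| * M + `|phi x0| + `|C| * (M + M)) => i tau Ai te.
have [h1 h2] := hM i tau Ai te.
have [h3 _] := hM i 0 Ai z0; have [h4 _] := hM i0 0 Ai0 z0.
split.
  have := C' _ _ (hP _ _ Ai te) (hP _ _ Ai0 z0) h1 h4.
  have : `|h i tau - h i0 0| <= M + M.
    by apply: (le_trans (ler_normB _ _)); exact: lerD.
  move=> /(ler_wpM2l (normr_ge0 C)) H1 H2.
  have := ler_normD (phi (h i tau) - phi x0) (phi x0); rewrite subrK => H3.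
  have : 0 <= `|C| * M by rewrite mulr_ge0.
  by move: H1 H2 H3; rewrite /x0; lra.
apply: (le_trans (C' _ _ (hP _ _ Ai te) (hP _ _ Ai z0) h1 h3)).
apply: (le_trans (ler_wpM2l (normr_ge0 C) h2)); rewrite mulrA ler_wpM2r//.
by rewrite -addrA lerDl addr_ge0// mulr_ge0// addr_ge0.
Qed.

Lemma unif_lip0_powR_ge1 h r : 1 <= r ->
  (forall i tau, A i -> `|tau| <= e -> 0 <= h i tau) ->
  unif_lip0 h -> unif_lip0 (fun i tau => h i tau `^ r).
Proof.
move=> r1; apply: (@unif_lip0_comp [set x | 0 <= x] (@powR R ^~ r)) => M.
have [C hC] := powR_lipschitz_ge1 M r1.
exists C => x y /= x0 y0 xM yM.
by apply: hC; apply/andP; split => //; exact: le_trans (ler_norm _) _.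
Qed.

Lemma unif_lip0_powR_gt0 a h r : 0 < a ->
  (forall i tau, A i -> `|tau| <= e -> a <= h i tau) ->
  unif_lip0 h -> unif_lip0 (fun i tau => h i tau `^ r).
Proof.
move=> a0; apply: (@unif_lip0_comp [set x | a <= x] (@powR R ^~ r)) => M.
have [C hC] := powR_lipschitz_gt0 M r a0.
exists C => x y /= x0 y0 xM yM.
by apply: hC; apply/andP; split => //; exact: le_trans (ler_norm _) _.
Qed.

End uniformly_lipschitz_at0.

(** * Differentiability of powers, including at a zero of the base *)

Section derivable_powR.
Context {R : realType}.
Implicit Types (X x y z : R -> R) (r : R).

Lemma derivable_addf x y (t : R) : derivable x t 1 -> derivable y t 1 ->
  derivable (fun tau => x tau + y tau) t 1.
Proof. exact: (@derivableD _ _ _ x y t 1). Qed.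

Lemma derivable_mulf x y (t : R) : derivable x t 1 -> derivable y t 1 ->
  derivable (fun tau => x tau * y tau) t 1.
Proof. exact: (@derivableM _ _ x y t 1). Qed.

Lemma derivable_powR_gt0 X r : derivable X 0 1 -> 0 < X 0 ->
  derivable (fun tau => X tau `^ r) 0 1.
Proof.
move=> dX X0; apply/derivable1_diffP.
apply: (@differentiable_comp _ _ _ _ X (@powR R ^~ r)); first exact/derivable1_diffP.
by apply/derivable1_diffP/derivable_powR; rewrite in_itv/= X0.
Qed.

(** At a zero of the sum all three functions vanish, so the sum [X] has derivative 0. Where [X] is
    below 1, [0 <= X ^ r <= X], so the difference quotient of the power is squeezed to 0 as well.
    Elsewhere the chain rule applies. *)
Lemma derivable_powR_sum_sqr x y z r : 1 <= r ->
  derivable x 0 1 -> derivable y 0 1 -> derivable z 0 1 ->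
  derivable (fun tau => (x tau ^+ 2 + y tau ^+ 2 + z tau ^+ 2) `^ r) 0 1.
Proof.
move=> r1 dx dy dz.
pose X := fun tau => x tau ^+ 2 + y tau ^+ 2 + z tau ^+ 2.
have dX : derivable X 0 1.
  by apply: derivable_addf; [apply: derivable_addf|]; exact: derivable_mulf.
have [X0|X0] := eqVneq (X 0) 0; last first.
  apply: derivable_powR_gt0 => //; rewrite lt0r X0/=.
  by rewrite !addr_ge0 ?sqr_ge0.
have [x0 y0 z0] : [/\ x 0 = 0, y 0 = 0 & z 0 = 0].
  have := sqr_ge0 (x 0); have := sqr_ge0 (y 0); have := sqr_ge0 (z 0).
  move: X0; rewrite /X => X0 h1 h2 h3.
  by split; apply/eqP; rewrite -sqrf_eq0; apply/eqP; lra.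
have sqr0 (w : R -> R) : derivable w 0 1 -> w 0 = 0 ->
    is_derive (0 : R) 1 (fun tau => w tau ^+ 2) 0.
  move=> dw w0; have idw := derivableP dw.
  have -> : (fun tau => w tau ^+ 2) = w * w by apply/funext => tau; rewrite expr2.
  have := is_deriveM idw idw; rewrite w0 !scale0r addr0; exact.
have /cvg_ex[/= l Xl] := dX.
have l0 : l = 0.
  have XE : is_derive (0 : R) 1 X (0 + 0 + 0).
    exact: is_deriveD (is_deriveD (sqr0 _ dx x0) (sqr0 _ dy y0)) (sqr0 _ dz z0).
  have := @derive_val _ _ _ _ _ _ _ XE; rewrite !addr0 => <-.
  by rewrite /derive (cvg_lim _ Xl).
rewrite {}l0 in Xl; apply/cvg_ex; exists 0 => /=.
have X1 : \forall h \near 0^', X h < 1.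
  apply: nbhs_dnbhs.
  have cX : {for (0 : R), continuous X}.
    by apply: differentiable_continuous; exact/derivable1_diffP.
  by apply: (cvgr_lt (X 0) cX); rewrite X0.
apply/cvgrPdist_le => /= d d0; move/cvgrPdist_le : Xl => /(_ _ d0).
apply: filterS2 X1 => h X1.
rewrite !scaler1 !sub0r !normrN !addr0 -/(X 0) -/(X h) X0 subr0.
apply: le_trans; rewrite powR0 ?subr0 ?gt_eqF//; last lra.
have Xh : 0 <= X h by rewrite !addr_ge0 ?sqr_ge0.
rewrite !normrZ ler_wpM2l// !ger0_norm ?powR_ge0//.
have := @powR_le_mul _ 1 (X h) r r1; rewrite powR1 mul1r; apply.
by rewrite Xh ltW.
Qed.

End derivable_powR.

(** * Differentiation under the integral sign *)

Section derivable_integral.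
Context {R : realType} {d : measure_display} {T : measurableType d}.
Variable mu : {measure set T -> \bar R}.

Lemma derivable_integral_dominated (g : R -> T -> R) (H : T -> R) (e : R) :
  0 < e ->
  (forall tau, `|tau| <= e -> mu.-integrable setT (EFin \o g tau)) ->
  mu.-integrable setT (EFin \o H) ->
  (forall tau x, `|tau| <= e -> `|g tau x - g 0 x| <= `|tau| * H x) ->
  (forall x, derivable (g ^~ x) 0 1) ->
  derivable (fun tau => fine (\int[mu]_x (g tau x)%:E)%E) 0 1.
Proof.
move=> e0 ig iH gH dg.
pose quot h x := h^-1 * (g h x - g 0 x).
have z0 : `|0 : R| <= e by rewrite normr0 ltW.
have iquot h : `|h| <= e -> mu.-integrable setT (EFin \o quot h).
  move=> he; rewrite (_ : _ \o _ = fun x => (h^-1%:E * ((EFin \o g h) x - (EFin \o g 0%R) x))%E).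
    by apply: integrableZl => //; apply: integrableB => //; exact: ig.
  by apply/funext => x /=; rewrite -EFinB -EFinM.
have quotE h : `|h| <= e -> h^-1 *: (fine (\int[mu]_x (g (h *: 1 + 0)%R x)%:E)%E
    - fine (\int[mu]_x (g 0%R x)%:E)%E) = fine (\int[mu]_x (quot h x)%:E)%E.
  move=> he; rewrite scaler1 addr0.
  rewrite -[RHS]/(\int[mu]_x (quot h x)) RintegralZl//.
    by rewrite RintegralB//; exact: ig.
  rewrite (_ : _ \o _ = fun x => ((EFin \o g h) x - (EFin \o g 0%R) x)%E)//.
  by apply: integrableB => //; exact: ig.
pose dq x : R := lim (quot h x @[h --> 0^']).
have quot_cvg x : quot h x @[h --> 0^'] --> dq x.
  have /cvg_ex[/= l gl] := dg x.
  have {}gl : quot h x @[h --> 0^'] --> l.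
    by move: gl; under eq_fun do rewrite scaler1 addr0.
  by rewrite /dq (cvg_lim _ gl).
apply/cvg_ex; exists (fine (\int[mu]_x (dq x)%:E)%E) => /=.
(* Dominated convergence is sequential, so the limit is tested along sequences of nonzero increments
   tending to 0, shifted by [N] to keep every term within [e]. *)
apply/cvgr_dnbhsP => u [u0 ucv].
have [N _ uN] : \forall n \near \oo, `|u n| <= e.
  move/cvgrPdist_le : ucv => /(_ _ e0); apply: filterS => n.
  by rewrite sub0r normrN.
have {}uN n : `|u (n + N)%N| <= e by apply: uN; exact: leq_addl.
rewrite -(cvg_shiftn N) /=.
under eq_fun do rewrite quotE//.
have quotu_cvg x : (quot (u (n + N)%N) x) @[n --> \oo] --> dq x.
  have /cvgr_dnbhsP/(_ u (conj u0 ucv)) := quot_cvg x.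
  by rewrite -(cvg_shiftn N).
have mdq : measurable_fun setT (EFin \o dq : T -> \bar R).
  apply: (@emeasurable_fun_cvg _ _ _ _ (fun n => EFin \o quot (u (n + N)%N))).
    by move=> n; have /integrableP[] := iquot _ (uN n).
  by move=> x _; apply: cvg_EFin; [exact: nearW|exact: quotu_cvg].
have quotH n x : (`|(quot (u (n + N)%N) x)%:E| <= (H x)%:E)%E.
  rewrite /quot abse_EFin lee_fin normrM normfV ler_pdivrMl ?normr_gt0 ?u0//.
  exact: gH.
have [idq _ icvg] : [/\ mu.-integrable setT (EFin \o dq), True &
    (\int[mu]_x (quot (u (n + N)%N) x)%:E)%E @[n --> \oo] -->
    (\int[mu]_x (dq x)%:E)%E].
  have [] := @dominated_convergence _ _ _ mu setT measurableT
      (fun n x => (quot (u (n + N)%N) x)%:E) (EFin \o dq) (EFin \o H) => //.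
  - by move=> n; have /integrableP[] := iquot _ (uN n).
  - by apply: aeW => x _; apply: cvg_EFin; [exact: nearW|exact: quotu_cvg].
  - by apply: aeW => x n _.
apply: fine_cvg; rewrite fineK//.
exact: (integrable_fin_num measurableT idq).
Qed.

End derivable_integral.

(** * Integrability of a power singularity on the line *)

Section integral_singular.
Context {R : realType}.
Notation mu := (@lebesgue_measure R).

(** The integrand may blow up at the endpoints, so the fundamental theorem is applied on compact
    subintervals exhausting the open one. There the integral is a difference of two values of [F],
    and monotone convergence passes to the limit. *)
Lemma ge0_integral_oo_le (f F : R -> R) (a b C : R) : a < b ->
  (forall x, a < x < b -> 0 <= f x) ->
  (forall x, a < x < b -> {for x, continuous f}) ->
  (forall x, a < x < b -> is_derive x 1 F (f x)) ->
  (forall x, a < x < b -> `|F x| <= C) ->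
  (\int[mu]_(x in `]a, b[) (f x)%:E <= (C + C)%:E)%E.
Proof.
move=> ab f0 cf dF FC.
(* Starting at 3 keeps [del n] below half the length, so that no subinterval is degenerate. *)
pose del n := (b - a) / n.+3%:R.
have del0 n : 0 < del n by rewrite divr_gt0// subr_gt0.
pose S n : set R := `[a + del n, b - del n]%classic.
have Sab n x : S n x -> a < x < b.
  by rewrite /S/= in_itv/=; have := del0 n; lra.
have ndS : {homo S : n m / (n <= m)%N >-> (n <= m)%O}.
  move=> n m nm; apply/subsetPset => x; rewrite /S/= !in_itv/= => xn.
  have : del m <= del n.
    by rewrite /del ler_pM2l ?subr_gt0// lef_pV2 ?posrE// ler_nat !ltnS.
  lra.
have SE : \bigcup_n S n = `]a, b[%classic.
  apply/seteqP; split=> [x [n _ /Sab]|x] /=; rewrite in_itv//=.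
  move=> xab; have m0 : 0 < Num.min (x - a) (b - x) / (b - a).
    by rewrite divr_gt0 ?subr_gt0// lt_min; lra.
  have [k] := ltr_add_invr m0; rewrite add0r ltr_pdivlMr ?subr_gt0// => km.
  have : del k < Num.min (x - a) (b - x).
    apply: le_lt_trans km; rewrite /del [leLHS]mulrC.
    apply: ler_wpM2r; first by rewrite subr_ge0 ltW.
    by rewrite lef_pV2 ?posrE ?ler_nat ?ltr0n// -addn2 leq_addr.
  rewrite lt_min => /andP[h1 h2]; exists k => //; rewrite /S/= in_itv/=; lra.
have cS n : {within S n, continuous f}.
  by apply: continuous_in_subspaceT => x /set_mem /Sab; exact: cf.
have mS n : measurable_fun (S n) (EFin \o f).
  apply/measurable_EFinP.
  apply: subspace_continuous_measurable_fun; first exact: measurable_itv.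
  exact: cS.
have : (\int[mu]_(x in S i) (f x)%:E)%E @[i --> \oo] -->
    (\int[mu]_(x in \bigcup_i S i) (f x)%:E)%E.
  apply: ge0_nondecreasing_set_cvg_integral => //.
    by move=> n; exact: measurable_itv.
  by move=> n x /Sab /f0; rewrite lee_fin.
rewrite SE => icv.
rewrite -(cvg_lim _ icv)//; apply: lime_le; first by apply/cvg_ex; eexists; exact: icv.
apply: nearW => n.
have dn : a + del n < b - del n.
  have -> : b - del n = a + (b - a) - del n by ring.
  have : b - a = del n * n.+3%:R by rewrite /del divfK.
  have : del n * 3%:R <= del n * n.+3%:R.
    by apply: ler_wpM2l; [exact: ltW|rewrite ler_nat].
  have := del0 n; lra.
have cF : {within S n, continuous F}.
  by apply: derivable_within_continuous => x /Sab /dF dFx; exact: ex_derive.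
rewrite (@continuous_FTC2 _ f F)//; last 3 first.
- exact: cS.
- have [h1 h2 h3] := (continuous_within_itvP _ dn).1 cF.
  by split => // x /subset_itv_oo_cc /Sab /dF dFx; exact: ex_derive.
- move=> x /subset_itv_oo_cc /Sab /dF dFx.
  by rewrite derive1E; exact: derive_val.
rewrite -EFinB lee_fin; apply: (le_trans (ler_norm _)).
apply: (le_trans (ler_normB _ _)).
by apply: lerD; apply: FC; have := del0 n; lra.
Qed.

Lemma measurable_abs_powR (b c : R) :
  measurable_fun setT (fun x : R => `|x - c| `^ b).
Proof.
apply: (measurableT_comp (measurable_powR b)).
apply: measurableT_comp => //; apply: measurable_funB => //.
Qed.

(** The singular point is removed as a null set. On each half the antiderivative is, up to sign,
    [|x - c| ^ (1 - b) / (1 - b)], bounded by [C], so each half contributes at most [2 * C]. *)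
Lemma integral_abs_powR_le (b L c : R) : 0 <= b < 1 -> 0 < L ->
  (\int[mu]_(x in `](c - L)%R, (c + L)%R[) (`|x - c| `^ (- b))%:E
    <= (4 * (L `^ (1 - b) / (1 - b)))%:E)%E.
Proof.
move=> /andP[b0 b1] L0; set I := `]_, _[%classic; set C := _ / _.
have mf (D : set R) : measurable D -> measurable_fun D (fun x : R => (`|x - c| `^ (- b))%:E).
  by move=> mD; apply: measurable_funTS; apply/measurable_EFinP; exact: measurable_abs_powR.
have IE : I `\ c = `]c - L, c[%classic `|` `]c, c + L[%classic.
  apply/seteqP; split=> x; rewrite /I/=.
    rewrite !in_itv/= => -[xI /eqP]; rewrite neq_lt => /orP[] xc; [left|right]; lra.
  rewrite !in_itv/= => xI; split; first by case: xI; lra.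
  by apply/eqP; rewrite neq_lt; case: xI => xI; apply/orP; [left|right]; lra.
have mI : measurable (I `\ c) by rewrite IE; apply: measurableU; exact: measurable_itv.
rewrite -(integral_setD1 mI (mf _ mI)).
rewrite IE ge0_integral_setU//=; first last.
- apply/disj_set2P; rewrite -subset0 => x [/=].
  by rewrite !in_itv/=; lra.
- by rewrite -IE; exact: mf.
have powE (x : R) : x `^ (1 - b - 1) = x `^ (- b).
  by congr (_ `^ _); lra.
have Fle (x : R) : 0 < x < L -> `|x `^ (1 - b) / (1 - b)| <= C.
  move=> xL; rewrite ger0_norm; last by rewrite divr_ge0 ?powR_ge0//; lra.
  rewrite /C; apply: ler_wpM2r; first by rewrite invr_ge0; lra.
  by apply: ge0_ler_powR; rewrite ?nnegrE; lra.
have cf (x : R) : x - c != 0 -> {for x, continuous (fun x : R => `|x - c| `^ (- b))}.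
  move=> xc; apply: (@continuous_comp _ _ _ (fun x : R => `|x - c|) (@powR R ^~ (- b))).
    apply: (@continuous_comp _ _ _ (fun x : R => x - c) (@Num.norm R R)).
      by apply: continuousB => //; exact: cst_continuous.
    exact: norm_continuous.
  apply: differentiable_continuous; apply/derivable1_diffP/derivable_powR.
  by rewrite in_itv/= andbT normr_gt0.
(* Both halves at once: [k] is the slope 1 or -1 of [g], and the outer factor [k] cancels the one
   produced by the chain rule. *)
have dpow (g : R -> R) (x k : R) : k * k = 1 -> 0 < g x -> is_derive x 1 g k ->
    is_derive x 1 (fun y => k * (g y `^ (1 - b) / (1 - b))) (`|g x| `^ (- b)).
  move=> kk gx dgx; have h2 := is_derive1_powR (1 - b) gx.
  have h3 := @is_derive1_comp _ (@powR R ^~ (1 - b)) g x _ _ h2 dgx.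
  have -> : (fun y => k * (g y `^ (1 - b) / (1 - b))) =
      (k / (1 - b)) \*: ((@powR R ^~ (1 - b)) \o g).
    by apply/funext => y /=; rewrite /GRing.scale/=; ring.
  apply: is_derive_eq; rewrite powE gtr0_norm// /GRing.scale/=.
  have b1' : 1 - b != 0 by rewrite gt_eqF//; lra.
  by transitivity (k * k * g x `^ (- b)); [field|rewrite kk mul1r].
have -> : (4 * C)%:E = ((C + C)%:E + (C + C)%:E)%E by rewrite -EFinD; congr EFin; ring.
apply: leeD.
- apply: (@ge0_integral_oo_le _ (fun x => -1 * ((c - x) `^ (1 - b) / (1 - b)))).
  + lra.
  + by move=> x _; exact: powR_ge0.
  + by move=> x xI; apply: cf; rewrite lt_eqF//; lra.
  + move=> x xI; rewrite distrC; apply: (dpow (fun x => c - x)); [lra|lra|].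
    by rewrite -[-1]add0r; exact: is_deriveB.
  + by move=> x xI; rewrite mulN1r normrN; apply: Fle; lra.
- apply: (@ge0_integral_oo_le _ (fun x => 1 * ((x - c) `^ (1 - b) / (1 - b)))).
  + lra.
  + by move=> x _; exact: powR_ge0.
  + by move=> x xI; apply: cf; rewrite gt_eqF//; lra.
  + move=> x xI; apply: (dpow (fun x => x - c)); [lra|lra|].
    by rewrite -[X in is_derive _ _ _ X]subr0; exact: is_deriveB.
  + by move=> x xI; rewrite mul1r; apply: Fle; lra.
Qed.

End integral_singular.

(** * Distance on the circle, periodic functions with Hoelder derivative, and minors *)

Section circle.
Context {R : realType}.
Implicit Types (s t u x y z alpha M : R) (f g : R -> R).

(** For parameters in one period [[0, 2 * pi]] this is the arc distance on the circle. *)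
Definition circ_dist s t : R := Num.min `|s - t| (2 * pi - `|s - t|).

Definition in_period s := 0 <= s <= 2 * pi.

(* The bound on the derivative is only needed on [-4 pi, 4 pi], which contains every
   lift provided by [circ_dist_lift] below. *)
Definition hoelder1 alpha M f : Prop :=
  [/\ forall x, f (x + 2 * pi) = f x,
      forall x, derivable f x 1,
      continuous (derive1 f),
      forall x, `|x| <= 4 * pi -> `|(derive1 f) x| <= M &
      forall x y, `|(derive1 f) x - (derive1 f) y| <= M * `|x - y| `^ alpha].

Lemma circ_distC s t : circ_dist s t = circ_dist t s.
Proof. by rewrite /circ_dist distrC. Qed.

Lemma circ_dist_ge0 s t : in_period s -> in_period t -> 0 <= circ_dist s t.
Proof.
rewrite /in_period => hs ht; rewrite le_min normr_ge0 subr_ge0 ler_norml; lra.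
Qed.

Lemma circ_dist_le s t : circ_dist s t <= 2 * pi.
Proof. by rewrite ge_min gerBl normr_ge0 orbT. Qed.

(** One of [t], [t - 2 * pi], [t + 2 * pi] realises the circle distance as a distance on the line.
    Periodic functions do not see the change, so the mean value theorem on the line yields bounds in
    the circle distance. *)
Lemma circ_dist_lift s t : in_period s -> in_period t ->
  exists t', [/\ `|t' - s| = circ_dist s t, `|t'| <= 4 * pi &
    forall (T : Type) (f : R -> T), (forall x, f (x + 2 * pi) = f x) -> f t' = f t].
Proof.
rewrite /in_period /circ_dist => hs ht; have p0 := @pi_gt0 R.
have [h|h] := leP `|s - t| (2 * pi - `|s - t|).
  exists t; split; [by rewrite distrC| |by []].
  by rewrite ler_norml; lra.
have [st|st] := leP s t.
  exists (t - 2 * pi); split.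
  - have stE : `|s - t| = - (s - t) by rewrite ler0_norm//; lra.
    by rewrite stE in h *; rewrite ler0_norm; lra.
  - by rewrite ler_norml; lra.
  - by move=> T f fp; rewrite -fp subrK.
exists (t + 2 * pi); split.
- have stE : `|s - t| = s - t by rewrite ger0_norm//; lra.
  by rewrite stE in h *; rewrite ger0_norm; lra.
- by rewrite ler_norml; lra.
- by move=> T f fp; rewrite fp.
Qed.

Lemma circ_dist0_eq (T : Type) (f : R -> T) s t : in_period s -> in_period t ->
  (forall x, f (x + 2 * pi) = f x) -> circ_dist s t = 0 -> f s = f t.
Proof.
move=> hs ht fp d0; have [t' [h _ /(_ _ _ fp) <-]] := circ_dist_lift hs ht.
by move/eqP: h; rewrite d0 normr_eq0 subr_eq0 => /eqP ->.
Qed.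

Lemma in_period_norm s : in_period s -> `|s| <= 4 * pi.
Proof. by have := @pi_gt0 R; rewrite /in_period ler_norml; lra. Qed.

Lemma MVT_between f x y : (forall z, derivable f z 1) ->
  exists z, f y - f x = (derive1 f) z * (y - x) /\ (x <= z <= y \/ y <= z <= x).
Proof.
move=> df.
have H a b : a <= b -> exists2 z, a <= z <= b & f b - f a = (derive1 f) z * (b - a).
  move=> ab; have [||z] := @MVT_segment R f (derive1 f) a b ab.
  - move=> z _; rewrite derive1E; exact/derivableP.
  - by apply: derivable_within_continuous.
  - by rewrite in_itv/= => zab fE; exists z.
have [xy|/ltW yx] := leP x y.
  by have [z ? ?] := H _ _ xy; exists z; split => //; left.
have [z zi fE] := H _ _ yx; exists z; split; last by right.
by rewrite -opprB fE -mulrN opprB.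
Qed.

(** The mean value point lies between [s] and [t']: it stays in the range where the derivative is
    bounded, and it is no farther from [s] than [t'] is. *)
Lemma hoelder1_lift alpha M f s t' : hoelder1 alpha M f -> 0 <= alpha -> 0 <= M ->
  `|s| <= 4 * pi -> `|t'| <= 4 * pi ->
  exists z, [/\ f t' - f s = (derive1 f) z * (t' - s), `|z - s| <= `|t' - s|,
    `|(derive1 f) z| <= M & `|(derive1 f) z - (derive1 f) s| <= M * `|t' - s| `^ alpha].
Proof.
move=> [fp df cf fM fH] a0 M0 hs ht.
have [z [fE zi]] := MVT_between s t' df.
have zs : `|z - s| <= `|t' - s|.
  case: zi => zi; first by rewrite !ger0_norm; lra.
  by rewrite !ler0_norm; lra.
exists z; split => //.
  by apply: fM; move: hs ht; rewrite !ler_norml; case: zi; lra.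
apply: (le_trans (fH _ _)); apply: ler_wpM2l => //.
by apply: ge0_ler_powR; rewrite ?nnegrE.
Qed.

Lemma hoelder1_lip alpha M f s t : hoelder1 alpha M f -> 0 <= alpha -> 0 <= M ->
  in_period s -> in_period t -> `|f t - f s| <= M * circ_dist s t.
Proof.
move=> fh a0 M0 hs ht; have [t' [td tpi tp]] := circ_dist_lift hs ht.
have [z [fE _ fz _]] := hoelder1_lift fh a0 M0 (in_period_norm hs) tpi.
have [fp _ _ _ _] := fh.
by rewrite -(tp _ f fp) fE normrM td; apply: ler_wpM2r; first exact: circ_dist_ge0.
Qed.

Definition minor f g s t u : R :=
  (f t - f s) * (g u - g s) - (g t - g s) * (f u - f s).

(** After the mean value theorem the minor is the product of the two increments and a 2 by 2
    determinant of derivatives. If all derivatives were taken at the same point the determinant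
    would vanish, so the Hoelder bound makes it small. *)
Lemma minor_le alpha M f g s t u m :
  hoelder1 alpha M f -> hoelder1 alpha M g -> 0 <= alpha -> 0 <= M ->
  in_period s -> in_period t -> in_period u ->
  circ_dist s t <= m -> circ_dist s u <= m ->
  `|minor f g s t u| <=
    (2 * M * M * 2 `^ alpha) * (circ_dist s t * circ_dist s u * m `^ alpha).
Proof.
move=> fh gh a0 M0 hs ht hu dtm dum.
have [t' [td tpi tp]] := circ_dist_lift hs ht.
have [u' [ud upi up]] := circ_dist_lift hs hu.
have hs' := in_period_norm hs.
have [zf [ftE zfs fzM _]] := hoelder1_lift fh a0 M0 hs' tpi.
have [zg [gtE zgs gzM _]] := hoelder1_lift gh a0 M0 hs' tpi.
have [wf [fuE wfs fwM _]] := hoelder1_lift fh a0 M0 hs' upi.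
have [wg [guE wgs gwM _]] := hoelder1_lift gh a0 M0 hs' upi.
have [fp _ _ _ fH] := fh; have [gp _ _ _ gH] := gh.
have m0 : 0 <= m by apply: le_trans dtm; exact: circ_dist_ge0.
(* Both mean value points are within [m] of [s], hence within [2 * m] of each other; this gives the
   factor [2 ^ alpha]. *)
have hold h z w : hoelder1 alpha M h -> `|z - s| <= `|t' - s| ->
    `|w - s| <= `|u' - s| -> `|(derive1 h) z - (derive1 h) w| <= M * (2 `^ alpha * m `^ alpha).
  move=> [_ _ _ _ hH] hz hw; apply: (le_trans (hH _ _)); apply: ler_wpM2l => //.
  rewrite -powRM//; apply: ge0_ler_powR; rewrite ?nnegrE ?mulr_ge0//.
  have -> : z - w = (z - s) - (w - s) by ring.
  by apply: (le_trans (ler_normB _ _)); rewrite td in hz; rewrite ud in hw; lra.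
have := hold _ _ _ fh zfs wfs; have := hold _ _ _ gh zgs wgs.
set B := M * _ => gB fB.
rewrite /minor -(tp _ _ fp) -(tp _ _ gp) -(up _ _ fp) -(up _ _ gp) ftE gtE fuE guE.
have -> : (derive1 f) zf * (t' - s) * ((derive1 g) wg * (u' - s)) -
    (derive1 g) zg * (t' - s) * ((derive1 f) wf * (u' - s)) =
  (t' - s) * (u' - s) * (((derive1 f) zf - (derive1 f) wf) * (derive1 g) wg
    - (derive1 f) wf * ((derive1 g) zg - (derive1 g) wg)) by ring.
rewrite !normrM td ud.
have -> : 2 * M * M * 2 `^ alpha * (circ_dist s t * circ_dist s u * m `^ alpha) =
  circ_dist s t * circ_dist s u * (B * M + M * B) by rewrite /B; ring.
apply: ler_wpM2l; first by rewrite mulr_ge0// circ_dist_ge0.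
by apply: (le_trans (ler_normB _ _)); rewrite !normrM lerD// ler_pM.
Qed.

Definition circ_diam s t u : R :=
  Num.max (Num.max (circ_dist s t) (circ_dist s u)) (circ_dist t u).

(** The vertex opposite to a longest side, of length [m], serves as base point. Its two adjacent
    sides come from [minor_le], and the third side is the factor [m] in
    [m ^ alpha = m * m ^ (alpha - 1)], an identity that for [alpha > 0] also holds at [m = 0]. *)
Lemma minor_le_diam alpha M f g s t u :
  hoelder1 alpha M f -> hoelder1 alpha M g -> 0 < alpha -> 0 <= M ->
  in_period s -> in_period t -> in_period u ->
  `|minor f g s t u| <= (2 * M * M * 2 `^ alpha) *
    (circ_dist s t * circ_dist s u * circ_dist t u * circ_diam s t u `^ (alpha - 1)).
Proof.
move=> fh gh a0 M0 hs ht hu; set m := circ_diam s t u.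
have a0' := ltW a0.
have mst : circ_dist s t <= m by rewrite /m /circ_diam !le_max lexx.
have msu : circ_dist s u <= m by rewrite /m /circ_diam !le_max lexx orbT.
have mtu : circ_dist t u <= m by rewrite /m /circ_diam !le_max lexx orbT.
have m0 : 0 <= m by apply: le_trans mst; exact: circ_dist_ge0.
have mE : m `^ alpha = m * m `^ (alpha - 1) by rewrite mulr_powRB1.
have [h|[h|h]] : circ_dist t u = m \/ circ_dist s u = m \/ circ_dist s t = m.
- rewrite /m /circ_diam /Num.max; case: ifP => _; first by left.
  by case: ifP => _; right; [left|right].
- have := minor_le fh gh a0' M0 hs ht hu mst msu.
  move=> /le_trans; apply; rewrite mE -h le_eqVlt; apply/orP; left; apply/eqP; ring.
- have := minor_le fh gh a0' M0 ht hs hu; rewrite circ_distC => /(_ _ mst mtu).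
  have -> : `|minor f g t s u| = `|minor f g s t u|.
    by rewrite -normrN; congr (`|_|); rewrite /minor; ring.
  move=> /le_trans; apply; rewrite mE -h le_eqVlt; apply/orP; left; apply/eqP; ring.
- have := minor_le fh gh a0' M0 hu hs ht.
  rewrite (circ_distC u) (circ_distC u t) => /(_ _ msu mtu).
  have -> : `|minor f g u s t| = `|minor f g s t u|.
    by congr (`|_|); rewrite /minor; ring.
  move=> /le_trans; apply; rewrite mE -h le_eqVlt; apply/orP; left; apply/eqP; ring.
Qed.

Lemma continuous_circ_dist :
  continuous (fun x : R * R => circ_dist x.1 x.2).
Proof.
have c1 : continuous (fun x : R * R => `|x.1 - x.2|).
  move=> x; apply: (@continuous_comp _ _ _ (fun x : R * R => x.1 - x.2) (@Num.norm R R)).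
    by apply: cvgB; [exact: cvg_fst|exact: cvg_snd].
  exact: norm_continuous.
move=> x; rewrite /circ_dist.
apply: (@continuous_min _ _ (fun x : R * R => `|x.1 - x.2|) (fun x : R * R => 2 * pi - `|x.1 - x.2|)).
  exact: c1.
by apply: cvgB; [exact: cvg_cst|exact: c1].
Qed.

(** The vector inequality [|v|^2 / 2 - |v'|^2 <= |v + v'|^2]: the difference of its sides is
    [|v + 2 v'|^2 / 2]. It carries lower bounds over to perturbed vectors. *)
Lemma sum_sqr_lower (a b c a' b' c' : R) :
  (a ^+ 2 + b ^+ 2 + c ^+ 2) / 2 - (a' ^+ 2 + b' ^+ 2 + c' ^+ 2)
  <= (a + a') ^+ 2 + (b + b') ^+ 2 + (c + c') ^+ 2.
Proof.
rewrite -subr_ge0.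
have -> : (a + a') ^+ 2 + (b + b') ^+ 2 + (c + c') ^+ 2 -
  ((a ^+ 2 + b ^+ 2 + c ^+ 2) / 2 - (a' ^+ 2 + b' ^+ 2 + c' ^+ 2)) =
  ((a + 2 * a') ^+ 2 + (b + 2 * b') ^+ 2 + (c + 2 * c') ^+ 2) / 2 by field.
by rewrite divr_ge0// !addr_ge0// sqr_ge0.
Qed.

End circle.

(** * Continuity of arithmetic expressions *)

Section continuous_arith.
Context {R : realType} {T : topologicalType}.
Implicit Types f g : T -> R.

Lemma continuous_addf f g : continuous f -> continuous g ->
  continuous (fun x => f x + g x).
Proof.
by move=> cf cg x; apply: (@continuousD _ R T f g x); [exact: cf|exact: cg].
Qed.

Lemma continuous_subf f g : continuous f -> continuous g ->
  continuous (fun x => f x - g x).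
Proof.
by move=> cf cg x; apply: (@continuousB _ R T f g x); [exact: cf|exact: cg].
Qed.

Lemma continuous_sqrf f : continuous f -> continuous (fun x => f x ^+ 2).
Proof.
by move=> cf x; apply: (@continuousM _ T f f x); exact: cf.
Qed.

End continuous_arith.

(** * Lower bounds for the speed and the chords of a simple regular curve *)

Section lower_bounds.
Context {R : realType}.
Variables (alpha M : R) (f0 f1 f2 : R -> R).
Hypotheses (alpha0 : 0 < alpha) (M0 : 0 <= M).
Hypotheses (fh0 : hoelder1 alpha M f0) (fh1 : hoelder1 alpha M f1)
  (fh2 : hoelder1 alpha M f2).
Hypothesis reg : forall x,
  0 < derive1 f0 x ^+ 2 + derive1 f1 x ^+ 2 + derive1 f2 x ^+ 2.
Hypothesis simple : forall s t, in_period s -> in_period t ->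
  0 < circ_dist s t ->
  0 < (f0 t - f0 s) ^+ 2 + (f1 t - f1 s) ^+ 2 + (f2 t - f2 s) ^+ 2.

Lemma speed_lower : exists2 c, 0 < c & forall x, in_period x ->
  c <= derive1 f0 x ^+ 2 + derive1 f1 x ^+ 2 + derive1 f2 x ^+ 2.
Proof.
pose h x := derive1 f0 x ^+ 2 + derive1 f1 x ^+ 2 + derive1 f2 x ^+ 2.
have hc : continuous h.
  move=> x; have [_ _ c0 _ _] := fh0; have [_ _ c1 _ _] := fh1.
  have [_ _ c2 _ _] := fh2.
  exact: (continuous_addf (continuous_addf (continuous_sqrf c0)
    (continuous_sqrf c1)) (continuous_sqrf c2)).
have [||x _ hx] := @EVT_min R h 0 (2 * pi).
- by rewrite mulr_ge0// ltW// pi_gt0.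
- exact: continuous_subspaceT.
- exists (h x); first exact: reg.
  by move=> y hy; apply: hx; rewrite in_itv.
Qed.

Let chord s t := (f0 t - f0 s) ^+ 2 + (f1 t - f1 s) ^+ 2 + (f2 t - f2 s) ^+ 2.

(** Near the diagonal the chord is the derivative at [s], up to a small Hoelder error, times the
    increment of the parameter; the lower bound on the speed absorbs the error. *)
Lemma chord_lower_near : exists c del, [/\ 0 < c, 0 < del & forall s t,
  in_period s -> in_period t -> circ_dist s t <= del ->
  c * circ_dist s t ^+ 2 <= chord s t].
Proof.
have [c0 c00 speed] := speed_lower.
(* Three squared errors of at most [c0 / 12] leave [c0 / 2 - c0 / 4 = c0 / 4]; the minimum with 1
   gives [eps ^ 2 <= eps]. *)
pose eps := Num.min 1 (c0 / 12).
have eps0 : 0 < eps by rewrite lt_min ltr01 divr_gt0.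
have epsc : eps ^+ 2 <= c0 / 12.
  have : eps <= 1 /\ eps <= c0 / 12 by rewrite /eps !ge_min !lexx orbT.
  by move=> [h1 h2]; rewrite expr2; apply: le_trans h2; rewrite ger_pMr.
(* Chosen so that [M * del ^ alpha <= eps]; [M + 1] avoids a division by 0. *)
pose del := (eps / (M + 1)) `^ (alpha^-1).
have M1 : 0 < M + 1 by rewrite ltr_wpDl.
have dela : del `^ alpha = eps / (M + 1).
  by rewrite /del -powRrM mulVf ?gt_eqF// powRr1// divr_ge0// ltW.
exists (c0 / 4), del; split; [lra|by rewrite powR_gt0// divr_gt0|].
move=> s t hs ht dst.
have [t' [td tpi tp]] := circ_dist_lift hs ht.
have d0 := circ_dist_ge0 hs ht.
have key f : hoelder1 alpha M f -> exists2 e : R, e ^+ 2 <= c0 / 12 &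
    f t - f s = (derive1 f s + e) * (t' - s).
  move=> fh; have [fp _ _ _ _] := fh.
  have [z [fE _ _ zH]] := hoelder1_lift fh (ltW alpha0) M0 (in_period_norm hs) tpi.
  exists (derive1 f z - derive1 f s); last first.
    by rewrite (addrC (derive1 f s)) subrK -fE (tp _ _ fp).
  apply: le_trans epsc; rewrite -real_normK ?num_real// lerXn2r ?nnegrE ?(ltW eps0)//.
  apply: (le_trans zH); apply: (@le_trans _ _ (M * (eps / (M + 1)))).
    apply: ler_wpM2l => //; rewrite -dela td.
    by apply: ge0_ler_powR; rewrite ?nnegrE// ?powR_ge0// ltW.
  by rewrite mulrCA ger_pMr// ler_pdivrMr//; lra.
have [e0 he0 E0] := key _ fh0; have [e1 he1 E1] := key _ fh1.
have [e2 he2 E2] := key _ fh2.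
rewrite /chord E0 E1 E2 -td real_normK ?num_real// !exprMn -!mulrDl.
apply: ler_wpM2r; first exact: sqr_ge0.
apply: le_trans (sum_sqr_lower _ _ _ _ _ _).
by have := speed _ hs; lra.
Qed.

(** Close pairs are covered by [chord_lower_near], the others by simplicity and compactness of the
    square of the period. *)
Lemma chord_lower : exists2 c, 0 < c & forall s t,
  in_period s -> in_period t -> c * circ_dist s t ^+ 2 <= chord s t.
Proof.
have [c0 [del [c00 del0 near]]] := chord_lower_near.
(* The second term makes [h] positive on the whole square, also near the diagonal. *)
pose h (x : R * R) := chord x.1 x.2 + Num.max 0 (del - circ_dist x.1 x.2).
have cont f : hoelder1 alpha M f -> continuous (fun x : R * R => (f x.2 - f x.1) ^+ 2).
  move=> [_ df _ _ _] x.
  have cf : continuous f.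
    by move=> y; apply: differentiable_continuous; exact/derivable1_diffP.
  apply: (@continuous_sqrf _ _ (fun x : R * R => f x.2 - f x.1)).
  apply: (@continuous_subf _ _ (f \o snd) (f \o fst)) => y.
    by apply: (@continuous_comp _ _ _ snd f); [exact: cvg_snd|exact: cf].
  by apply: (@continuous_comp _ _ _ fst f); [exact: cvg_fst|exact: cf].
have hc : continuous h.
  apply: continuous_addf.
    exact: (continuous_addf (continuous_addf (cont _ fh0) (cont _ fh1)) (cont _ fh2)).
  move=> x.
  apply: (@continuous_max _ _ (cst 0) (fun x : R * R => del - circ_dist x.1 x.2)).
    exact: cst_continuous.
  apply: (@continuous_subf _ _ (cst del)); first exact: cst_continuous.
  exact: continuous_circ_dist.
have pi0 := @pi_gt0 R.
have [|||x hx hmin] := @compact_EVT_min _ R h (`[0, 2 * pi]%classic `*` `[0, 2 * pi]%classic).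
- by exists (0, 0); split => /=; rewrite in_itv/=; lra.
- by apply: compact_setX; exact: segment_compact.
- exact: continuous_subspaceT.
have {}hmin s t : in_period s -> in_period t -> h x <= h (s, t).
  by move=> hs ht; apply: hmin; rewrite inE; split => /=; rewrite in_itv.
have hx0 : 0 < h x.
  move: hx; rewrite inE /= => -[]; rewrite !in_itv/= => x1 x2.
  have ch0 : 0 <= chord x.1 x.2 by rewrite !addr_ge0// sqr_ge0.
  have [d0|d0] := leP (circ_dist x.1 x.2) 0.
    by rewrite ltr_wpDl// lt_max; apply/orP; right; lra.
  by rewrite ltr_pwDl// ?le_max ?lexx//; exact: simple.
exists (Num.min c0 (h x / (2 * pi) ^+ 2)).
  by rewrite lt_min c00 divr_gt0// exprn_gt0// mulr_gt0.
move=> s t hs ht; have d0 := circ_dist_ge0 hs ht.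
have [dd|dd] := leP (circ_dist s t) del.
  apply: le_trans (near _ _ hs ht dd); apply: ler_wpM2r; first exact: sqr_ge0.
  by rewrite ge_min lexx.
(* Beyond [del] the added term of [h] is 0, so the minimum of [h] bounds the chord itself. Dividing
   by [(2 * pi) ^ 2], an upper bound of the squared circle distance, makes the bound quadratic. *)
have := hmin _ _ hs ht; rewrite {2}/h/= max_l; last lra.
rewrite addr0; apply: le_trans.
apply: (@le_trans _ _ (h x / (2 * pi) ^+ 2 * circ_dist s t ^+ 2)).
  by apply: ler_wpM2r; [exact: sqr_ge0|rewrite ge_min lexx orbT].
rewrite -mulrA ger_pMr// mulrC ler_pdivrMr ?exprn_gt0 ?mulr_gt0// mul1r.
by rewrite lerXn2r ?nnegrE ?mulr_ge0 ?(ltW pi0)// circ_dist_le.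
Qed.

End lower_bounds.

(** * The integrand in coordinates *)

Local Notation ix := (@Ordinal 3 0 isT).
Local Notation iy := (@Ordinal 3 1 isT).
Local Notation iz := (@Ordinal 3 2 isT).

Section density.
Context {R : realType}.
Implicit Types (f g v w : 'I_3 -> R -> R) (s t u tau p : R).

Definition sqnorm3 (a : 'I_3 -> R) : R := a ix ^+ 2 + a iy ^+ 2 + a iz ^+ 2.

Definition chord2 f s t : R := sqnorm3 (fun i => f i t - f i s).

Definition area2 f s t u : R :=
  minor (f iy) (f iz) s t u ^+ 2 + minor (f iz) (f ix) s t u ^+ 2 +
  minor (f ix) (f iy) s t u ^+ 2.

(* Lengths enter through their squares, so that every base of a power is a polynomial
   in the parameter of a linear perturbation. *)
Definition menger_density p f v s t u : R :=
  2 `^ p * area2 f s t u `^ (p / 2) *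
  (chord2 f s t * chord2 f u s * chord2 f t u) `^ (- (p / 2)) *
  (sqnorm3 (v ^~ s) `^ 2^-1 * sqnorm3 (v ^~ t) `^ 2^-1 * sqnorm3 (v ^~ u) `^ 2^-1).

Definition perturb f g tau : 'I_3 -> R -> R := fun i x => f i x + tau * g i x.

Definition separated (x : R * R * R) : Prop :=
  [/\ in_period x.1.1, in_period x.1.2, in_period x.2 &
  [/\ 0 < circ_dist x.1.1 x.1.2, 0 < circ_dist x.2 x.1.1 & 0 < circ_dist x.1.2 x.2]].

Lemma sqnorm3_ge0 (a : 'I_3 -> R) : 0 <= sqnorm3 a.
Proof. by rewrite !addr_ge0// sqr_ge0. Qed.

Lemma area2_ge0 f s t u : 0 <= area2 f s t u.
Proof. by rewrite !addr_ge0// sqr_ge0. Qed.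

Lemma enorm3E (a : 'rV[R]_3) : enorm3 a = sqnorm3 (a 0) `^ 2^-1.
Proof.
rewrite powR12_sqrt ?sqnorm3_ge0// /enorm3 /sqnorm3 !big_ord_recl big_ord0 addr0.
rewrite addrA; congr (Num.sqrt (a 0 _ ^+ 2 + a 0 _ ^+ 2 + a 0 _ ^+ 2)); exact: val_inj.
Qed.

(** The square roots merge with the outer power into the exponent [p / 2]. Coinciding points are
    included, because both sides take the inverse of 0 to be 0. *)
Lemma menger_integrandE p (F : R -> 'rV[R]_3) s t u :
  menger_curv F s t u `^ p * enorm3 (derive1 F s) * enorm3 (derive1 F t) *
    enorm3 (derive1 F u) =
  menger_density p (fun i x => F x 0 i) (fun i x => derive1 F x 0 i) s t u.
Proof.
have assoc (a b c d : R) : a * b * c * d = a * (b * c * d) by ring.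
rewrite assoc /menger_density; congr (_ * _); last by rewrite !enorm3E.
pose f := fun i x => F x 0 i.
have cE a b : sqnorm3 ((F b - F a) 0) = chord2 f a b.
  by rewrite /chord2 /sqnorm3 !mxE.
rewrite /menger_curv !enorm3E !cE.
have -> : sqnorm3 (cross3 (F t - F s) (F u - F s) 0) = area2 f s t u.
  by rewrite /area2 /sqnorm3 /minor /cross3 !mxE/=.
have h0 := area2_ge0 f s t u; have c0 a b : 0 <= chord2 f a b by exact: sqnorm3_ge0.
have cc0 : 0 <= chord2 f s t * chord2 f u s by exact: mulr_ge0.
rewrite -(powRM _ (c0 s t) (c0 u s)) -(powRM _ cc0 (c0 t u)).
set Q := chord2 f s t * _ * _.
have Q0 : 0 <= Q by rewrite !mulr_ge0.
have b0 : 0 <= (Q `^ 2^-1)^-1 by rewrite invr_ge0 powR_ge0.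
have a0 : 0 <= 2 * area2 f s t u `^ 2^-1 by rewrite mulr_ge0// powR_ge0.
rewrite (powRM _ a0 b0) powRM ?powR_ge0//.
rewrite -powRN -!powRrM; congr (_ * _ `^ _ * _ `^ _); first by rewrite mulrC.
by rewrite mulNr mulrC.
Qed.

(** The quadratic term is kept as a product of two multiples of [tau], the shape to which the
    product rules apply. *)
Lemma minor_perturb f g i j tau s t u :
  minor (perturb f g tau i) (perturb f g tau j) s t u =
  minor (f i) (f j) s t u +
  tau * (minor (f i) (g j) s t u + minor (g i) (f j) s t u) +
  tau * (tau * minor (g i) (g j) s t u).
Proof. by rewrite /minor /perturb; ring. Qed.

End density.

(** * Uniform estimates for the perturbed integrand *)

Section density_estimates.
Context {R : realType}.
Variables (alpha M : R) (f g : 'I_3 -> R -> R).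
Hypotheses (alpha0 : 0 < alpha) (M0 : 0 <= M).
Hypotheses (fh : forall i, hoelder1 alpha M (f i))
           (gh : forall i, hoelder1 alpha M (g i)).
Hypothesis reg : forall x, 0 < sqnorm3 (fun i => derive1 (f i) x).
Hypothesis simple : forall s t, in_period s -> in_period t ->
  0 < circ_dist s t -> 0 < chord2 f s t.

Let df i := derive1 (f i).
Let dg i := derive1 (g i).

Section chords.
Context {I : Type} (A : set I) (e : R) (a b : I -> R).
Hypothesis Aab : forall i, A i ->
  [/\ in_period (a i), in_period (b i) & 0 < circ_dist (a i) (b i)].

(** Each coordinate of the chord divided by the circle distance is affine in [tau], with both
    coefficients bounded by [M]. *)
Lemma unif_lip0_chord2 : unif_lip0 A e (fun i tau =>
  chord2 (perturb f g tau) (a i) (b i) / circ_dist (a i) (b i) ^+ 2).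
Proof.
have bound h i : hoelder1 alpha M h -> A i ->
    `|(h (b i) - h (a i)) / circ_dist (a i) (b i)| <= M.
  move=> hh /Aab[ha hb d0]; rewrite normrM normfV (gtr0_norm d0) ler_pdivrMr//.
  by apply: hoelder1_lip hh _ _ _ _ => //; exact: ltW.
have aff k : unif_lip0 A e (fun i tau =>
    (f k (b i) - f k (a i)) / circ_dist (a i) (b i) +
    tau * ((g k (b i) - g k (a i)) / circ_dist (a i) (b i))).
  by apply: (@unif_lip0_affine _ _ _ _ _ _ M) => i Ai; exact: bound.
apply: eq_unif_lip0 (unif_lip0D (unif_lip0D (unif_lip0_sqr (aff ix))
  (unif_lip0_sqr (aff iy))) (unif_lip0_sqr (aff iz))) => i tau /Aab[_ _ d0].
rewrite /chord2 /sqnorm3 /perturb; field.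
by rewrite gt_eqF.
Qed.

Lemma unif_lip0_speed2 : unif_lip0 A e (fun i tau =>
  sqnorm3 (fun k => perturb df dg tau k (a i))).
Proof.
have bound h i : hoelder1 alpha M h -> A i -> `|derive1 h (a i)| <= M.
  by move=> [_ _ _ hM _] /Aab[ha _ _]; apply: hM; exact: in_period_norm.
have aff k : unif_lip0 A e (fun i tau => df k (a i) + tau * dg k (a i)).
  by apply: (@unif_lip0_affine _ _ _ _ _ _ M) => i Ai; exact: bound.
exact: (unif_lip0D (unif_lip0D (unif_lip0_sqr (aff ix))
  (unif_lip0_sqr (aff iy))) (unif_lip0_sqr (aff iz))).
Qed.

End chords.

(** The lower bounds for the unperturbed curve survive by [sum_sqr_lower] once the perturbation is
    small at the scale of the circle distance. *)
Lemma perturb_lower : exists e c, [/\ 0 < e, 0 < c,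
  forall tau s t, `|tau| <= e -> in_period s -> in_period t ->
    c * circ_dist s t ^+ 2 <= chord2 (perturb f g tau) s t &
  forall tau s, `|tau| <= e -> in_period s ->
    c <= sqnorm3 (fun k => perturb df dg tau k s)].
Proof.
have [c1 c10 chl] := chord_lower alpha0 M0 (fh ix) (fh iy) (fh iz) reg simple.
have [c2 c20 spl] := speed_lower (fh ix) (fh iy) (fh iz) reg.
pose c := Num.min c1 c2.
have c0 : 0 < c by rewrite lt_min c10.
have cc1 : c <= c1 by rewrite ge_min lexx.
have cc2 : c <= c2 by rewrite ge_min lexx orbT.
(* Since [e ^ 2 <= e] and [12 * (M ^ 2 + 1) * e <= c], each squared coordinate of the perturbation
   costs at most [c / 12], so three of them leave [c / 4] out of [c / 2]. *)
pose e := Num.min 1 (c / (12 * (M ^+ 2 + 1))).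
have M2 : 0 <= M ^+ 2 by exact: sqr_ge0.
have e0 : 0 < e by rewrite lt_min ltr01 divr_gt0//; lra.
have small tau y (D : R) : `|tau| <= e -> `|y| <= M * D -> (tau * y) ^+ 2 <= c / 12 * D ^+ 2.
  move=> te yM.
  have ty : `|tau| * `|y| <= e * (M * D) by exact: ler_pM.
  rewrite -real_normK ?num_real// normrM.
  apply: (@le_trans _ _ ((e * (M * D)) ^+ 2)).
    have ty0 : 0 <= `|tau| * `|y| by rewrite mulr_ge0.
    by rewrite lerXn2r ?nnegrE// (le_trans ty0 ty).
  have e1 : e ^+ 2 <= e.
    by rewrite expr2 ger_pMr// /e ge_min lexx.
  have : e * (12 * (M ^+ 2 + 1)) <= c.
    by rewrite -ler_pdivlMr ?ge_min ?lexx ?orbT//; lra.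
  move=> ec; rewrite !exprMn mulrA; apply: ler_wpM2r; first exact: sqr_ge0.
  apply: (@le_trans _ _ (e * M ^+ 2)); first exact: ler_wpM2r.
  by rewrite ler_pdivlMr//; nra.
exists e, (c / 4); split; [by []|lra| |].
- move=> tau s t te hs ht; rewrite /chord2 /sqnorm3 /perturb.
  have E k : f k t + tau * g k t - (f k s + tau * g k s) =
    (f k t - f k s) + tau * (g k t - g k s) by ring.
  rewrite !E; apply: le_trans (sum_sqr_lower _ _ _ _ _ _).
  have hl k := small tau _ _ te (hoelder1_lip (gh k) (ltW alpha0) M0 hs ht).
  have := hl ix; have := hl iy; have := hl iz; have := chl _ _ hs ht.
  have : c * circ_dist s t ^+ 2 <= c1 * circ_dist s t ^+ 2.
    by apply: ler_wpM2r => //; exact: sqr_ge0.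
  by lra.
- move=> tau s te hs; rewrite /sqnorm3 /perturb.
  apply: le_trans (sum_sqr_lower _ _ _ _ _ _).
  have hl k : (tau * dg k s) ^+ 2 <= c / 12 * 1 ^+ 2.
    apply: small => //; rewrite mulr1; have [_ _ _ gM _] := gh k.
    by apply: gM; exact: in_period_norm.
  have := hl ix; have := hl iy; have := hl iz; have := spl _ hs.
  by rewrite expr1n mulr1 /df; lra.
Qed.

Variables (p : R) (p2 : 2 <= p).

Let side_prod (x : R * R * R) :=
  circ_dist x.1.1 x.1.2 * circ_dist x.2 x.1.1 * circ_dist x.1.2 x.2.

Let diam (x : R * R * R) := circ_diam x.1.1 x.1.2 x.2.

Let diam_gt0 x : separated x -> 0 < diam x.
Proof. by move=> [_ _ _ [h _ _]]; rewrite /diam /circ_diam !lt_max h. Qed.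

Let side_prod_gt0 x : separated x -> 0 < side_prod x.
Proof. by move=> [_ _ _ [h1 h2 h3]]; rewrite /side_prod !mulr_gt0. Qed.

(** The natural size of the minors, read off from [minor_le_diam]. *)
Let scale x := side_prod x * diam x `^ (alpha - 1).

Let unif_lip0_minor e k l : unif_lip0 [set x : R * R * R | separated x] e (fun x tau =>
  minor (perturb f g tau k) (perturb f g tau l) x.1.1 x.1.2 x.2 / scale x).
Proof.
pose C := 2 * M * M * 2 `^ alpha.
have bound h1 h2 x : hoelder1 alpha M h1 -> hoelder1 alpha M h2 -> separated x ->
    `|minor h1 h2 x.1.1 x.1.2 x.2 / scale x| <= C.
  move=> hh1 hh2 ok; have [hs ht hu _] := ok.
  have sc0 : 0 < scale x by rewrite mulr_gt0 ?side_prod_gt0// powR_gt0// diam_gt0.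
  rewrite normrM normfV (gtr0_norm sc0) ler_pdivrMr//.
  apply: (le_trans (minor_le_diam hh1 hh2 alpha0 M0 hs ht hu)).
  by rewrite (circ_distC x.1.1 x.2).
have C0 : 0 <= C by rewrite !mulr_ge0// powR_ge0.
have h1 : unif_lip0 [set x : R * R * R | separated x] e (fun x tau =>
    minor (f k) (f l) x.1.1 x.1.2 x.2 / scale x + tau *
    ((minor (f k) (g l) x.1.1 x.1.2 x.2 + minor (g k) (f l) x.1.1 x.1.2 x.2) / scale x)).
  apply: (@unif_lip0_affine _ _ _ _ _ _ (C + C)) => x ok.
    by apply: (le_trans (bound _ _ _ (fh k) (fh l) ok)); rewrite lerDl.
  rewrite mulrDl; apply: (le_trans (ler_normD _ _)).
  by apply: lerD; exact: bound.
(* The parameter [tau] itself, one of the two factors of the quadratic term. *)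
have h2 : unif_lip0 [set x : R * R * R | separated x] e (fun (_ : R * R * R) tau => 0 + tau * 1).
  by apply: (@unif_lip0_affine _ _ _ _ _ _ 1) => x ok; rewrite ?normr0 ?normr1.
have h3 : unif_lip0 [set x : R * R * R | separated x] e (fun x tau =>
    0 + tau * (minor (g k) (g l) x.1.1 x.1.2 x.2 / scale x)).
  by apply: (@unif_lip0_affine _ _ _ _ _ _ C) => x ok; rewrite ?normr0//; exact: bound.
apply: eq_unif_lip0 (unif_lip0D h1 (unif_lip0M h2 h3)) => x tau _.
by rewrite minor_perturb; ring.
Qed.

(** Each factor is divided by its natural scale. The normalised density [nd] is then a product of
    uniformly bounded and Lipschitz families, and a power of the diameter remains as weight. *)
Lemma menger_density_bound : exists e C, [/\ 0 < e, 0 <= C & forall tau x,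
  `|tau| <= e -> separated x ->
  let G tau := menger_density p (perturb f g tau) (perturb df dg tau)
    x.1.1 x.1.2 x.2 in
  `|G tau| <= C * diam x `^ ((alpha - 1) * p) /\
  `|G tau - G 0| <= `|tau| * (C * diam x `^ ((alpha - 1) * p))].
Proof.
have [e [c [e0 c0 chl spl]]] := perturb_lower.
pose A := [set x : R * R * R | separated x].
have A12 x : A x -> [/\ in_period x.1.1, in_period x.1.2 & 0 < circ_dist x.1.1 x.1.2].
  by move=> [h1 h2 h3 [h4 h5 h6]].
have A31 x : A x -> [/\ in_period x.2, in_period x.1.1 & 0 < circ_dist x.2 x.1.1].
  by move=> [h1 h2 h3 [h4 h5 h6]].
have A23 x : A x -> [/\ in_period x.1.2, in_period x.2 & 0 < circ_dist x.1.2 x.2].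
  by move=> [h1 h2 h3 [h4 h5 h6]].
pose q (a b : R * R * R -> R) x tau :=
  chord2 (perturb f g tau) (a x) (b x) / circ_dist (a x) (b x) ^+ 2.
pose v (a : R * R * R -> R) x tau := sqnorm3 (fun k => perturb df dg tau k (a x)).
pose area x tau :=
  (minor (perturb f g tau iy) (perturb f g tau iz) x.1.1 x.1.2 x.2 / scale x) ^+ 2 +
  (minor (perturb f g tau iz) (perturb f g tau ix) x.1.1 x.1.2 x.2 / scale x) ^+ 2 +
  (minor (perturb f g tau ix) (perturb f g tau iy) x.1.1 x.1.2 x.2 / scale x) ^+ 2.
pose s1 (x : R * R * R) := x.1.1.
pose s2 (x : R * R * R) := x.1.2.
pose s3 (x : R * R * R) := x.2.
pose nd x tau := 2 `^ p * area x tau `^ (p / 2) *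
  (q s1 s2 x tau * q s3 s1 x tau * q s2 s3 x tau) `^ (- (p / 2)) *
  (v s1 x tau `^ 2^-1 * v s2 x tau `^ 2^-1 * v s3 x tau `^ 2^-1).
have larea : unif_lip0 A e (fun x tau => area x tau `^ (p / 2)).
  apply: unif_lip0_powR_ge1; [by have := p2; lra|by move=> x tau _ _; rewrite !addr_ge0// sqr_ge0|].
  exact: (unif_lip0D (unif_lip0D (unif_lip0_sqr (unif_lip0_minor e iy iz))
    (unif_lip0_sqr (unif_lip0_minor e iz ix))) (unif_lip0_sqr (unif_lip0_minor e ix iy))).
have qlow a b x tau : (A x -> [/\ in_period (a x), in_period (b x) &
    0 < circ_dist (a x) (b x)]) -> A x -> `|tau| <= e -> c <= q a b x tau.
  by move=> H /H[ha hb d0] te; rewrite ler_pdivlMr ?exprn_gt0//; exact: chl.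
have lchord : unif_lip0 A e (fun x tau =>
    (q s1 s2 x tau * q s3 s1 x tau * q s2 s3 x tau) `^ (- (p / 2))).
  apply: (@unif_lip0_powR_gt0 _ _ _ _ (c * c * c)); first by rewrite !mulr_gt0.
    move=> x tau Ax te; apply: ler_pM; rewrite ?mulr_ge0// ?(ltW c0)//.
      by apply: ler_pM; rewrite ?(ltW c0)//; apply: qlow => //; [exact: A12|exact: A31].
    by apply: qlow => //; exact: A23.
  exact: (unif_lip0M (unif_lip0M (unif_lip0_chord2 e A12) (unif_lip0_chord2 e A31))
    (unif_lip0_chord2 e A23)).
have lspeed a b : (forall x, A x -> [/\ in_period (a x), in_period (b x) &
    0 < circ_dist (a x) (b x)]) -> unif_lip0 A e (fun x tau => v a x tau `^ 2^-1).
  move=> H; apply: (@unif_lip0_powR_gt0 _ _ _ _ c) => //.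
    by move=> x tau /H[ha _ _] te; exact: spl.
  exact: unif_lip0_speed2 H.
have lcst : unif_lip0 A e (fun x tau => 2 `^ p + tau * 0).
  apply: (@unif_lip0_affine _ _ _ _ _ _ (2 `^ p)) => x _; rewrite ?normr0 ?powR_ge0//.
  by rewrite ger0_norm ?powR_ge0.
have lnd : unif_lip0 A e nd.
  apply: eq_unif_lip0 (unif_lip0M (unif_lip0M (unif_lip0M lcst larea) lchord)
    (unif_lip0M (unif_lip0M (lspeed s1 s2 A12) (lspeed s2 s3 A23)) (lspeed s3 s1 A31))).
  by move=> x tau _; rewrite mulr0 addr0.
(* Count of powers: the area contributes [scale ^ p], that is, [side_prod ^ p] times
   [diam ^ ((alpha - 1) * p)], and the chords contribute [side_prod ^ (- p)], so the side lengths
   cancel. *)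
have ndE x tau : A x -> menger_density p (perturb f g tau) (perturb df dg tau)
    x.1.1 x.1.2 x.2 = nd x tau * diam x `^ ((alpha - 1) * p).
  move=> Ax; have [_ _ d12] := A12 _ Ax; have [_ _ d31] := A31 _ Ax.
  have [_ _ d23] := A23 _ Ax.
  have sc0 : 0 < scale x by rewrite mulr_gt0 ?side_prod_gt0// powR_gt0// diam_gt0.
  have scn0 : scale x != 0 by rewrite gt_eqF.
  have per0 := side_prod_gt0 Ax; have dm0 := diam_gt0 Ax.
  have areaE : area2 (perturb f g tau) x.1.1 x.1.2 x.2 = scale x ^+ 2 * area x tau.
    by rewrite /area2 /area; field.
  have chordE : chord2 (perturb f g tau) x.1.1 x.1.2 * chord2 (perturb f g tau) x.2 x.1.1 *
      chord2 (perturb f g tau) x.1.2 x.2 =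
      side_prod x ^+ 2 * (q s1 s2 x tau * q s3 s1 x tau * q s2 s3 x tau).
    rewrite /q /side_prod /s1 /s2 /s3; field.
    by rewrite !gt_eqF.
  have area0 : 0 <= area x tau by rewrite !addr_ge0// sqr_ge0.
  have q0 a b : 0 <= q a b x tau by rewrite divr_ge0 ?sqr_ge0// sqnorm3_ge0.
  rewrite /menger_density areaE chordE.
  have qq0 : 0 <= q s1 s2 x tau * q s3 s1 x tau * q s2 s3 x tau.
    exact: mulr_ge0 (mulr_ge0 (q0 _ _) (q0 _ _)) (q0 _ _).
  rewrite (powRM _ (sqr_ge0 _) area0) (powRM _ (sqr_ge0 _) qq0).
  have sqE (y r : R) : 0 <= y -> (y ^+ 2) `^ r = y `^ (2 * r).
    by move=> y0; rewrite -powR_mulrn// -powRrM.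
  rewrite !sqE ?(ltW per0) ?(ltW sc0)//.
  have -> : 2 * (p / 2) = p by field.
  have -> : 2 * - (p / 2) = - p by field.
  rewrite /scale powRM ?powR_ge0 ?(ltW per0)// -powRrM powRN.
  have pp0 : side_prod x `^ p != 0 by rewrite gt_eqF// powR_gt0.
  have alg (y1 y2 y3 y4 y5 y6 : R) : y6 != 0 ->
      y1 * (y6 * y4 * y2) * (y6^-1 * y3) * y5 = y1 * y2 * y3 * y5 * y4.
    by move=> y60; field.
  by rewrite (alg _ _ _ _ _ _ pp0).
have [C C0 hC] := unif_lip0_ge0 lnd.
exists e, C; split => // tau x te Ax /=.
have [h1 h2] := hC x tau Ax te.
rewrite !ndE// -mulrBl (normrM (nd x tau)) (normrM (nd x tau - nd x 0)) (ger0_norm (powR_ge0 _ _)); split.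
  by apply: ler_wpM2r; first exact: powR_ge0.
by rewrite mulrA (mulrC `|tau|); apply: ler_wpM2r; first exact: powR_ge0.
Qed.

Let derivable_affine (a b : R) : derivable (fun tau : R => a + tau * b) 0 1.
Proof.
apply: derivable_addf; first exact: derivable_cst.
by apply: derivable_mulf; [exact: derivable_id|exact: derivable_cst].
Qed.

(** At [tau = 0] chords and speeds are positive, so the chain rule handles their powers. The area
    may vanish and is covered by [derivable_powR_sum_sqr], as [p / 2 >= 1]. *)
Lemma derivable_menger_density x : separated x ->
  derivable (fun tau => menger_density p (perturb f g tau) (perturb df dg tau)
    x.1.1 x.1.2 x.2) 0 1.
Proof.
move=> [hs ht hu [d12 d31 d23]].
have dminor k l : derivable (fun tau =>
    minor (perturb f g tau k) (perturb f g tau l) x.1.1 x.1.2 x.2) 0 1.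
  under eq_fun do rewrite minor_perturb.
  apply: derivable_addf; first exact: derivable_affine.
  apply: derivable_mulf; first exact: derivable_id.
  by apply: derivable_mulf; [exact: derivable_id|exact: derivable_cst].
have dchord a b : derivable (fun tau => chord2 (perturb f g tau) a b) 0 1.
  have E k tau : perturb f g tau k b - perturb f g tau k a =
      (f k b - f k a) + tau * (g k b - g k a) by rewrite /perturb; ring.
  under eq_fun do rewrite /chord2 /sqnorm3 !E.
  have h k := @derivable_affine (f k b - f k a) (g k b - g k a).
  by apply: derivable_addf; [apply: derivable_addf|]; apply: derivable_mulf.
have dspeed a : derivable (fun tau => sqnorm3 (fun k => perturb df dg tau k a) `^ 2^-1) 0 1.
  apply: derivable_powR_gt0.
    have h k := @derivable_affine (df k a) (dg k a).
    by apply: derivable_addf; [apply: derivable_addf|]; apply: derivable_mulf.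
  have := reg a; rewrite /sqnorm3 /perturb !mul0r !addr0; exact.
have chord0 a b : in_period a -> in_period b -> 0 < circ_dist a b ->
    0 < chord2 (perturb f g 0) a b.
  move=> ha hb dab; have := simple ha hb dab.
  by rewrite /chord2 /sqnorm3 /perturb !mul0r !addr0.
rewrite /menger_density; apply: derivable_mulf; last first.
  by apply: derivable_mulf => //; exact: derivable_mulf.
apply: derivable_mulf.
  apply: derivable_mulf; first exact: derivable_cst.
  by apply: derivable_powR_sum_sqr => //; have := p2; lra.
apply: derivable_powR_gt0.
  by apply: derivable_mulf => //; exact: derivable_mulf.
by rewrite !mulr_gt0// chord0.
Qed.

(** If two parameters give the same point of the circle, periodicity makes their chord 0 for every
    [tau], and 0 to the nonzero power [- (p / 2)] is 0 by convention. *)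
Lemma menger_density_degenerate tau x :
  in_period x.1.1 -> in_period x.1.2 -> in_period x.2 -> ~ separated x ->
  menger_density p (perturb f g tau) (perturb df dg tau) x.1.1 x.1.2 x.2 = 0.
Proof.
move=> hs ht hu nok.
have ch0 a b : in_period a -> in_period b -> ~ (0 < circ_dist a b) ->
    chord2 (perturb f g tau) a b = 0.
  move=> ha hb; move/negP; rewrite -leNgt => d0.
  have {}d0 : circ_dist a b = 0 by apply/eqP; rewrite eq_le d0 circ_dist_ge0.
  have E k : perturb f g tau k b - perturb f g tau k a = 0.
    have [fp _ _ _ _] := fh k; have [gp _ _ _ _] := gh k.
    have := circ_dist0_eq ha hb fp d0; have := circ_dist0_eq ha hb gp d0.
    by rewrite /perturb => -> ->; rewrite subrr.
  by rewrite /chord2 /sqnorm3 !E expr0n !addr0.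
rewrite /menger_density.
suff -> : chord2 (perturb f g tau) x.1.1 x.1.2 * chord2 (perturb f g tau) x.2 x.1.1 *
    chord2 (perturb f g tau) x.1.2 x.2 = 0.
  by rewrite powR0 ?mulr0 ?mul0r// oppr_eq0 gt_eqF//; have := p2; lra.
have [h1|/(ch0 _ _ hs ht) ->] := pselect (0 < circ_dist x.1.1 x.1.2); last by rewrite !mul0r.
have [h2|/(ch0 _ _ hu hs) ->] := pselect (0 < circ_dist x.2 x.1.1); last by rewrite mulr0 mul0r.
have [h3|/(ch0 _ _ ht hu) ->] := pselect (0 < circ_dist x.1.2 x.2); last by rewrite mulr0.
by exfalso; apply: nok.
Qed.

End density_estimates.

(** * Measurability of the integrand *)

Section measurability.
Context {R : realType} {d : measure_display} {T : measurableType d}.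
Implicit Types (a b c : T -> R) (h k : R -> R).

Lemma measurable_minor h k a b c : measurable_fun setT h -> measurable_fun setT k ->
  measurable_fun setT a -> measurable_fun setT b -> measurable_fun setT c ->
  measurable_fun setT (fun x => minor h k (a x) (b x) (c x)).
Proof.
move=> mh mk ma mb mc.
have m (l : R -> R) a' b' : measurable_fun setT l -> measurable_fun setT a' ->
    measurable_fun setT b' -> measurable_fun setT (fun x : T => l (b' x) - l (a' x) : R).
  move=> ml ma' mb'.
  exact: (measurable_funB (measurableT_comp ml mb') (measurableT_comp ml ma')).
exact: (measurable_funB (measurable_funM (m _ _ _ mh ma mb) (m _ _ _ mk ma mc))
  (measurable_funM (m _ _ _ mk ma mb) (m _ _ _ mh ma mc))).
Qed.

Lemma measurable_sum_sqr a b c : measurable_fun setT a -> measurable_fun setT b ->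
  measurable_fun setT c ->
  measurable_fun setT (fun x => a x ^+ 2 + b x ^+ 2 + c x ^+ 2).
Proof.
move=> ma mb mc.
exact: (measurable_funD (measurable_funD (measurable_funX 2 ma)
  (measurable_funX 2 mb)) (measurable_funX 2 mc)).
Qed.

Lemma measurable_powR_comp r a : measurable_fun setT a ->
  measurable_fun setT (fun x => a x `^ r).
Proof. by move=> ma; exact: (measurableT_comp (measurable_powR r) ma). Qed.

Lemma measurable_menger_density p (f v : 'I_3 -> R -> R) a b c :
  (forall i, measurable_fun setT (f i)) -> (forall i, measurable_fun setT (v i)) ->
  measurable_fun setT a -> measurable_fun setT b -> measurable_fun setT c ->
  measurable_fun setT (fun x => menger_density p f v (a x) (b x) (c x)).
Proof.
move=> mf mv ma mb mc; rewrite /menger_density.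
have marea : measurable_fun setT (fun x => area2 f (a x) (b x) (c x)).
  by apply: measurable_sum_sqr; exact: measurable_minor.
have mchord a' b' : measurable_fun setT a' -> measurable_fun setT b' ->
    measurable_fun setT (fun x : T => chord2 f (a' x) (b' x)).
  move=> ma' mb'; apply: measurable_sum_sqr;
  exact: (measurable_funB (measurableT_comp (mf _) mb') (measurableT_comp (mf _) ma')).
have mspeed a' : measurable_fun setT a' ->
    measurable_fun setT (fun x : T => sqnorm3 (v ^~ (a' x)) `^ 2^-1).
  move=> ma'; apply: measurable_powR_comp; apply: measurable_sum_sqr;
  exact: (measurableT_comp (mv _) ma').
apply: measurable_funM; last first.
  exact: (measurable_funM (measurable_funM (mspeed _ ma) (mspeed _ mb)) (mspeed _ mc)).
apply: measurable_funM.
  by apply: measurable_funM; [exact: measurable_cst|exact: measurable_powR_comp].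
apply: measurable_powR_comp.
exact: (measurable_funM (measurable_funM (mchord _ _ ma mb) (mchord _ _ mc ma))
  (mchord _ _ mb mc)).
Qed.

End measurability.

(** * Triple integrals: Tonelli, a dominating kernel, and differentiation *)

Section triple_integral.
Context {R : realType} {d : measure_display} {T : measurableType d}.
Variable mu : {sigma_finite_measure set T -> \bar R}.

(* The sigma-finite structure that unification finds on [mu \x mu] is the one for
   subprobabilities, hence a constant with its own instance. *)
Definition square_measure : set (T * T) -> \bar R := (mu \x mu)%E.

HB.instance Definition _ := Measure.on square_measure.

(** The squares of an increasing exhaustion by sets of finite measure exhaust the product;
    monotonicity puts both coordinates into one member. *)
Let square_measure_sigma_finite : sigma_finite setT square_measure.
Proof.
have /sigma_finiteP[F [TF ndF Foo]] := sigma_finiteT mu.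
exists (fun n => F n `*` F n).
  rewrite -setXTT TF predeqE => -[x y]; split; last first.
    by move=> [n _ []/= ? ?]; split; exists n.
  move=> [/= [n _ Fnx] [k _ Fky]]; exists (maxn n k) => //; split.
  - by move: x Fnx; exact/subsetPset/ndF/leq_maxl.
  - by move: y Fky; exact/subsetPset/ndF/leq_maxr.
move=> k; have [? ?] := Foo k; split; first exact: measurableX.
by rewrite /square_measure product_measure1E// lte_mul_pinfty// ge0_fin_numE.
Qed.

HB.instance Definition _ := Measure_isSigmaFinite.Build _ _ _ square_measure
  square_measure_sigma_finite.

Notation mu3 := (square_measure \x mu)%E.

Lemma square_tonelli (G : T * T -> \bar R) :
  measurable_fun setT G -> (forall x, (0 <= G x)%E) ->
  (\int[square_measure]_x G x = \int[mu]_s \int[mu]_t G (s, t))%E.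
Proof. exact: fubini_tonelli1. Qed.

Lemma integral_triple (G : T * T * T -> \bar R) :
  measurable_fun setT G -> (forall x, (0 <= G x)%E) ->
  (\int[mu3]_x G x = \int[mu]_s \int[mu]_t \int[mu]_u G (s, t, u))%E.
Proof.
move=> mG G0.
have mF := measurable_fun_fubini_tonelli_F (m2 := mu) G mG G0.
have F0 x : (0 <= fubini_F mu G x)%E by exact: integral_ge0.
by rewrite (fubini_tonelli1 G mG G0) (square_tonelli mF F0).
Qed.

(** Integrating the last variable first costs a factor [B], the middle one another [B], and the
    first the finite measure of [D]. *)
Lemma integrable_chain (k : T * T -> R) (D : set T) (B : R) :
  measurable D -> (mu D < +oo)%E ->
  measurable_fun setT k -> (forall x, 0 <= k x) -> 0 <= B ->
  (forall s, (\int[mu]_t (k (s, t))%:E <= (B * \1_D s)%:E)%E) ->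
  mu3.-integrable setT (fun x => (k x.1 * k (x.1.2, x.2))%:E).
Proof.
move=> mD muD mk k0 B0 hk.
have mH : measurable_fun setT (fun x : T * T * T => k x.1 * k (x.1.2, x.2)).
  apply: measurable_funM; first exact: (measurableT_comp mk measurable_fst).
  apply: (measurableT_comp mk).
  apply: measurable_fun_pair; last exact: measurable_snd.
  exact: (measurableT_comp measurable_snd measurable_fst).
have ksec s : measurable_fun setT (fun t => (k (s, t))%:E).
  apply/measurable_EFinP; exact: (measurableT_comp mk (measurable_pair1 s)).
have mkE : measurable_fun setT (EFin \o k) by exact/measurable_EFinP.
have kE0 x : (0 <= (EFin \o k) x)%E by rewrite lee_fin.
pose H (x : T * T * T) := (k x.1 * k (x.1.2, x.2))%:E.
have mHE : measurable_fun setT H by exact/measurable_EFinP.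
have HE0 x : (0 <= H x)%E by rewrite lee_fin mulr_ge0.
apply/integrableP; split => //.
rewrite (_ : integral _ _ _ = \int[mu3]_x H x)%E; last first.
  by apply: eq_integral => x _; exact: (gee0_abs (HE0 x)).
rewrite (fubini_tonelli1 H mHE HE0).
apply: (@le_lt_trans _ _ (\int[square_measure]_x (B%:E * (EFin \o k) x))%E).
  apply: ge0_le_integral => //.
  - by move=> x _; exact: integral_ge0.
  - exact: measurable_fun_fubini_tonelli_F.
  - exact: measurable_funeM.
  move=> x _.
  have -> : fubini_F mu H x = ((k x)%:E * \int[mu]_u (k (x.2, u))%:E)%E.
    transitivity (\int[mu]_u ((k x)%:E * (k (x.2, u))%:E))%E.
      by rewrite /fubini_F; apply: eq_integral => u _; rewrite /H/= EFinM.
    by rewrite ge0_integralZl_EFin// => y _; rewrite lee_fin.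
  rewrite muleC; apply: lee_wpmul2r; first by rewrite lee_fin.
  apply: (le_trans (hk _)); by rewrite lee_fin ler_piMr.
rewrite ge0_integralZl_EFin// (square_tonelli mkE kE0).
have kfin : (\int[mu]_s \int[mu]_t (k (s, t))%:E < +oo)%E.
  apply: (@le_lt_trans _ _ (\int[mu]_s (B%:E * (\1_D s)%:E))%E).
    apply: ge0_le_integral => //.
    - by move=> x _; apply: integral_ge0 => t _; rewrite lee_fin.
    - exact: (measurable_fun_fubini_tonelli_F (m2 := mu) _ mkE kE0).
    - by apply: measurable_funeM; apply/measurable_EFinP; exact: measurable_indic.
  rewrite ge0_integralZl_EFin//; last first.
    by apply/measurable_EFinP; exact: measurable_indic.
  rewrite integral_indic// setIT.
  by apply: lte_mul_pinfty => //; rewrite lee_fin.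
by apply: lte_mul_pinfty => //; rewrite lee_fin.
Qed.

(** One integrable majorant serves twice: bounding [g] it gives finiteness near 0, and bounding the
    increments it feeds [derivable_integral_dominated]. *)
Lemma ederivable_triple_integral (g : R -> T * T * T -> R) (k : T * T -> R)
    (D : set T) (B C e : R) : 0 < e -> 0 <= B -> 0 <= C ->
  measurable D -> (mu D < +oo)%E ->
  measurable_fun setT k -> (forall x, 0 <= k x) ->
  (forall s, (\int[mu]_t (k (s, t))%:E <= (B * \1_D s)%:E)%E) ->
  (forall tau, measurable_fun setT (g tau)) ->
  (forall tau x, 0 <= g tau x) ->
  (forall tau x, `|tau| <= e -> `|g tau x| <= C * (k x.1 * k (x.1.2, x.2))) ->
  (forall tau x, `|tau| <= e ->
    `|g tau x - g 0 x| <= `|tau| * (C * (k x.1 * k (x.1.2, x.2)))) ->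
  (forall x, derivable (g ^~ x) 0 1) ->
  ederivable_at0 (fun tau =>
    \int[mu]_s \int[mu]_t \int[mu]_u (g tau (s, t, u))%:E)%E.
Proof.
move=> e0 B0 C0 mD muD mk k0 hk mg g0 gC gL dg.
have iE tau : (\int[mu]_s \int[mu]_t \int[mu]_u (g tau (s, t, u))%:E =
    \int[mu3]_x (g tau x)%:E)%E.
  rewrite (@integral_triple (EFin \o g tau))//; first exact/measurable_EFinP.
  by move=> x; rewrite lee_fin.
under eq_fun do rewrite iE.
have iH : mu3.-integrable setT (EFin \o (fun x => C * (k x.1 * k (x.1.2, x.2)))).
  rewrite (_ : _ \o _ = fun x => (C%:E * (k x.1 * k (x.1.2, x.2))%:E)%E).
    by apply: integrableZl => //; exact: (integrable_chain mD muD mk k0 B0 hk).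
  by apply/funext => x; rewrite /= -EFinM.
have ig tau : `|tau| <= e -> mu3.-integrable setT (EFin \o g tau).
  move=> te; apply: le_integrable iH => //; first exact/measurable_EFinP.
  move=> x _ /=; rewrite lee_fin.
  by rewrite [leRHS]ger0_norm ?gC// !mulr_ge0.
split; last exact: (derivable_integral_dominated e0 ig iH gL dg).
exists e => //= tau /=; rewrite sub0r normrN => /ltW te.
exact: (integrable_fin_num measurableT (ig _ te)).
Qed.

End triple_integral.

(** Replaces integrals over one period by integrals over the line, where the product measure
    lives. *)
Lemma integral_setE {R : realType} (D : set R) (h k : R -> \bar R) :
  (forall x, D x -> h x = k x) -> (forall x, ~ D x -> k x = 0%E) ->
  (\int[@lebesgue_measure R]_(x in D) h x = \int[@lebesgue_measure R]_x k x)%E.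
Proof.
move=> hk k0; rewrite integral_mkcond; apply: eq_integral => x _.
by rewrite patchE; case: ifPn => [/set_mem/hk//|/negP Dx]; rewrite k0// => /mem_set.
Qed.

(** * An integrable kernel dominating the singularity on the circle *)

Section singular_kernel.
Context {R : realType}.
Notation mu := (@lebesgue_measure R).
Variable b : R.
Hypothesis b01 : 0 <= b < 1.

Let P : set R := `[0, 2 * pi]%classic.

Let abs_pow (c : R -> R) (x : R * R) : R := `|x.2 - c x.1| `^ (- b).

(** On the period the circle distance from [s] to [t] is the distance on the line from [t] to one of
    [s], [s - 2 * pi], [s + 2 * pi]. Summing the three powers avoids choosing among them. *)
Definition circ_kernel (x : R * R) : R :=
  \1_P x.1 * (\1_P x.2 * (abs_pow id x + abs_pow (fun s => s - 2 * pi) x +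
    abs_pow (fun s => s + 2 * pi) x)).

Lemma circ_kernel_ge0 x : 0 <= circ_kernel x.
Proof. by rewrite /circ_kernel !mulr_ge0// !addr_ge0// powR_ge0. Qed.

Let measurable_abs_pow c : measurable_fun setT c ->
  measurable_fun setT (abs_pow c : measurableTypeR R * measurableTypeR R -> R).
Proof.
move=> mc; apply: (measurableT_comp (measurable_powR (- b))).
apply: measurableT_comp => //; apply: measurable_funB; first exact: measurable_snd.
exact: (measurableT_comp mc measurable_fst).
Qed.

Lemma measurable_circ_kernel :
  measurable_fun setT (circ_kernel : measurableTypeR R * measurableTypeR R -> R).
Proof.
have mP : measurable_fun setT (\1_P : measurableTypeR R -> R).
  by apply: measurable_indic; exact: measurable_itv.
apply: measurable_funM; first exact: (measurableT_comp mP measurable_fst).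
apply: measurable_funM; first exact: (measurableT_comp mP measurable_snd).
apply: measurable_funD; last first.
  by apply: measurable_abs_pow; apply: measurable_funD.
apply: measurable_funD; first exact: measurable_abs_pow.
by apply: measurable_abs_pow; apply: measurable_funB.
Qed.

Lemma circ_dist_powR_le_kernel s t : in_period s -> in_period t ->
  0 < circ_dist s t -> circ_dist s t `^ (- b) <= circ_kernel (s, t).
Proof.
move=> hs ht d0; rewrite /circ_kernel/= !indicE !mem_set /P/= ?in_itv//= !mul1r.
have h c : 0 <= abs_pow c (s, t) by exact: powR_ge0.
have h1 := h id; have h2 := h (fun s => s - 2 * pi); have h3 := h (fun s => s + 2 * pi).
rewrite {}/abs_pow/= in h1 h2 h3 *; move: hs ht; rewrite /in_period => hs ht.
rewrite /circ_dist; have [_|_] := leP `|s - t| (2 * pi - `|s - t|).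
  by rewrite (distrC s t); lra.
have [st|st] := leP s t.
  have -> : 2 * pi - `|s - t| = `|t - (s + 2 * pi)|.
    by rewrite !ler0_norm; lra.
  lra.
have -> : 2 * pi - `|s - t| = `|t - (s - 2 * pi)|.
  by rewrite !ger0_norm; lra.
lra.
Qed.

Lemma circ_kernel_integral : exists2 B, 0 <= B & forall s,
  (\int[mu]_t (circ_kernel (s, t))%:E <= (B * \1_P s)%:E)%E.
Proof.
have pi0 := @pi_gt0 R.
(* The centres lie in [[- 2 * pi, 4 * pi]], so an interval of this radius around any of them
   contains the period. *)
pose L : R := 4 * pi + 1.
pose C := 4 * (L `^ (1 - b) / (1 - b)).
have C0 : 0 <= C by rewrite mulr_ge0// divr_ge0 ?powR_ge0//; have := b01; lra.
have mf (D : set R) c : measurable D -> measurable_fun D (fun x : R => (`|x - c| `^ (- b))%:E).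
  by move=> mD; apply: measurable_funTS; apply/measurable_EFinP; exact: measurable_abs_powR.
have f0 c x : (0 <= (`|x - c| `^ (- b))%:E)%E by rewrite lee_fin powR_ge0.
have hC c : - (2 * pi) <= c <= 4 * pi ->
    (\int[mu]_(t in P) (`|t - c| `^ (- b))%:E <= C%:E)%E.
  move=> hc; apply: (@le_trans _ _
      (\int[mu]_(x in `](c - L)%R, (c + L)%R[) (`|x - c| `^ (- b))%:E)%E).
    apply: ge0_subset_integral.
    - exact: measurable_itv.
    - exact: measurable_itv.
    - by apply: mf; exact: measurable_itv.
    - by move=> x _; exact: f0.
    - by move=> x; rewrite /P/= !in_itv/= /L; lra.
  by apply: integral_abs_powR_le => //; rewrite /L; lra.
exists (C + C + C); first by rewrite !addr_ge0.
move=> s; have [sP|sP] := pselect (P s); last first.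
  rewrite indicE memNset// mulr0 integral0_eq// => t _.
  by rewrite /circ_kernel/= indicE memNset// mul0r.
rewrite indicE mem_set// mulr1.
have -> : (\int[mu]_t (circ_kernel (s, t))%:E = \int[mu]_(t in P)
    ((`|t - s| `^ (- b))%:E + (`|t - (s - 2 * pi)| `^ (- b))%:E +
     (`|t - (s + 2 * pi)| `^ (- b))%:E))%E.
  apply/esym/integral_setE => t tP.
    by rewrite /circ_kernel/= !indicE !mem_set// !mul1r.
  by rewrite /circ_kernel/= [X in _ * (X * _)]indicE memNset// mul0r mulr0.
have mP : measurable P by exact: measurable_itv.
rewrite ge0_integralD//; [|by move=> t _; rewrite adde_ge0|by apply: emeasurable_funD; exact: mf|exact: mf].
rewrite ge0_integralD//; [|exact: mf|exact: mf].
move: sP; rewrite /P/= in_itv/= => sP.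
by rewrite !EFinD; apply: leeD; [apply: leeD|]; apply: hC; lra.
Qed.

End singular_kernel.

(** * From vector-valued curves to their coordinates *)

Section curves.
Context {R : realType}.
Implicit Types (alpha M : R) (F : R -> 'rV[R]_3).

Lemma le_hoelder1 alpha M M' f : M <= M' -> hoelder1 alpha M f -> hoelder1 alpha M' f.
Proof.
move=> MM [h1 h2 h3 h4 h5]; split => //.
  by move=> x /h4; move/le_trans; apply.
by move=> x y; apply: (le_trans (h5 x y)); rewrite ler_wpM2r// powR_ge0.
Qed.

Lemma derive1_coord F x i : derivable F x 1 ->
  derive1 (fun y => F y 0 i) x = derive1 F x 0 i.
Proof. by move=> dF; rewrite !derive1E derive_mx// mxE. Qed.

Lemma normr_coord_le (a : 'rV[R]_3) i : `|a 0 i| <= enorm3 a.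
Proof.
rewrite -sqrtr_sqr ler_sqrt ?sumr_ge0// => [|j _]; last exact: sqr_ge0.
by rewrite (bigD1 i)//= lerDl sumr_ge0// => j _; exact: sqr_ge0.
Qed.

Lemma C1alpha_coord alpha F : 0 <= alpha -> C1alpha alpha F ->
  exists2 M, 0 <= M & forall i, hoelder1 alpha M (fun x => F x 0 i).
Proof.
move=> a0 [Fp dF cF [K FK]].
(* For [|x| <= 4 * pi] the Hoelder bound against the point 0 controls the derivative. *)
pose M0 := enorm3 (derive1 F 0) + `|K| * (4 * pi) `^ alpha.
have e0 : 0 <= enorm3 (derive1 F 0) by exact: sqrtr_ge0.
have M00 : 0 <= M0 by rewrite addr_ge0// mulr_ge0// powR_ge0.
have hold i x y : `|derive1 F x 0 i - derive1 F y 0 i| <= `|K| * `|x - y| `^ alpha.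
  have := normr_coord_le (derive1 F x - derive1 F y) i; rewrite !mxE => /le_trans; apply.
  by apply: (le_trans (FK _ _)); rewrite ler_wpM2r ?powR_ge0// ler_norm.
have DE i : derive1 (fun x => F x 0 i) = fun x => derive1 F x 0 i.
  by apply/funext => x; exact: derive1_coord.
exists (M0 + `|K|); first by rewrite addr_ge0.
move=> i; split; rewrite ?DE.
- by move=> x; rewrite Fp.
- by move=> x; exact: (derivable_mxP _ _ _).1 (dF x) _ _.
- move=> x; apply: (@continuous_comp _ _ _ (derive1 F) (fun a : 'rV[R]_3 => a 0 i)).
    exact: cF.
  exact: coord_continuous.
- move=> x xpi; have := hold i x 0; have := normr_coord_le (derive1 F 0) i.
  have := ler_normD (derive1 F x 0 i - derive1 F 0 0 i) (derive1 F 0 0 i).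
  rewrite subrK subr0 => h1 h2 h3.
  have h4 : `|x| `^ alpha <= (4 * pi) `^ alpha.
    apply: ge0_ler_powR; rewrite ?nnegrE//; exact: le_trans xpi.
  have := ler_wpM2l (normr_ge0 K) h4.
  by have := normr_ge0 K; rewrite /M0; lra.
- move=> x y; apply: (le_trans (hold i x y)); rewrite ler_wpM2r ?powR_ge0//.
  by rewrite lerDr.
Qed.

Lemma sqnorm3_gt0 (a : 'rV[R]_3) : a <> 0 -> 0 < sqnorm3 (a 0).
Proof.
move=> a0; rewrite lt0r sqnorm3_ge0 andbT; apply/eqP => aE; apply: a0.
have := sqr_ge0 (a 0 ix); have := sqr_ge0 (a 0 iy); have := sqr_ge0 (a 0 iz).
rewrite /sqnorm3 in aE => h1 h2 h3.
have z i : a 0 i ^+ 2 = 0 -> a 0 i = 0 by move/eqP; rewrite sqrf_eq0 => /eqP.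
apply/rowP => -[[|[|[|//]]] hi]; rewrite mxE.
- by rewrite (_ : Ordinal hi = ix); [apply: z; lra|exact: val_inj].
- by rewrite (_ : Ordinal hi = iy); [apply: z; lra|exact: val_inj].
- by rewrite (_ : Ordinal hi = iz); [apply: z; lra|exact: val_inj].
Qed.

(** Positive circle distance means [0 < |s - t| < 2 * pi], which excludes every integer multiple of
    the period. *)
Lemma simple_closed_chord2 F s t : simple_closed F -> 0 < circ_dist s t ->
  0 < chord2 (fun i x => F x 0 i) s t.
Proof.
move=> Fs; rewrite lt_min normr_gt0 subr_gt0 => /andP[st0 stpi].
have pi0 := @pi_gt0 R.
have FE : F s <> F t.
  apply: Fs => k kE; have [k0|k0] := eqVneq k 0.
    by move: st0; rewrite kE k0 mul0r eqxx.
  move: stpi; rewrite kE normrM (ger0_norm (_ : 0 <= 2 * pi)); last by rewrite mulr_ge0// ltW.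
  apply/negP; rewrite -leNgt ler_peMl ?mulr_ge0 ?(ltW pi0)//.
  by rewrite -intr_norm ler1z -gtz0_ge1 normr_gt0.
have := @sqnorm3_gt0 (F t - F s); rewrite /chord2 /sqnorm3 !mxE; apply.
by move=> /eqP; rewrite subr_eq0 => /eqP /esym.
Qed.

End curves.

(** * The perturbed energy and its differentiability *)

Lemma perturb_curve_integrand {R : realType} (p tau : R) (gamma Phi : R -> 'rV[R]_3)
    (s t u : R) :
  (forall x, derivable gamma x 1) -> (forall x, derivable Phi x 1) ->
  let F := fun x => gamma x + tau *: Phi x in
  let f := fun i x => gamma x 0 i in
  let g := fun i x => Phi x 0 i in
  menger_curv F s t u `^ p * enorm3 (derive1 F s) * enorm3 (derive1 F t) *
    enorm3 (derive1 F u) =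
  menger_density p (perturb f g tau)
    (perturb (fun i => derive1 (f i)) (fun i => derive1 (g i)) tau) s t u.
Proof.
move=> dgamma dPhi F f g.
have FE : (fun i x => F x 0 i) = perturb f g tau.
  by apply/funext => i; apply/funext => x; rewrite /perturb /F !mxE.
have dFE x : derive1 F x = derive1 gamma x + tau *: derive1 Phi x.
  rewrite !derive1E -deriveZ//.
  exact: (@deriveD _ _ _ gamma (tau \*: Phi) x 1 (dgamma x) (derivableZ (dPhi x))).
have dE : (fun i x => derive1 F x 0 i) =
    perturb (fun i => derive1 (f i)) (fun i => derive1 (g i)) tau.
  apply/funext => i; apply/funext => x.
  by rewrite /perturb /f /g !derive1_coord// dFE !mxE.
by have := menger_integrandE p F s t u; rewrite FE dE.
Qed.

Theorem mainTheorem2 (R : realType) (p alpha : R)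
    (hp : 2 <= p)
    (halpha1 : 1 - 2 / p < alpha) (halpha2 : alpha <= 1)
    (gamma Phi : R -> 'rV[R]_3)
    (hgamma : C1alpha alpha gamma)
    (hsimple : simple_closed gamma)
    (hregular : regular_curve gamma)
    (hPhi : C1alpha alpha Phi) :
  ederivable_at0
    (fun tau : R => menger_energy p (fun x : R => gamma x + tau *: Phi x)).
Proof.
have p0 : 0 < p by lra.
have alpha0 : 0 < alpha.
  by apply: le_lt_trans halpha1; rewrite subr_ge0 ler_pdivrMr// mul1r.
pose b := (1 - alpha) * p / 2.
have b01 : 0 <= b < 1.
  have : (1 - alpha) * p < 2 by rewrite -ltr_pdivlMr//; lra.
  have : 0 <= (1 - alpha) * p by rewrite mulr_ge0 ?subr_ge0// ltW.
  by rewrite /b; lra.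
have [M1 M10 fh1] := C1alpha_coord (ltW alpha0) hgamma.
have [M2 M20 gh2] := C1alpha_coord (ltW alpha0) hPhi.
pose M := M1 + M2.
have M0 : 0 <= M by exact: addr_ge0.
pose f i x := gamma x 0 i.
pose g i x := Phi x 0 i.
have fh i : hoelder1 alpha M (f i) by apply: le_hoelder1 (fh1 i); rewrite lerDl.
have gh i : hoelder1 alpha M (g i) by apply: le_hoelder1 (gh2 i); rewrite lerDr.
have [_ dgamma _ _] := hgamma; have [_ dPhi _ _] := hPhi.
have reg x : 0 < sqnorm3 (fun i => derive1 (f i) x).
  have := sqnorm3_gt0 (hregular x).
  by rewrite /sqnorm3 /f !derive1_coord.
have simple s t : in_period s -> in_period t -> 0 < circ_dist s t -> 0 < chord2 f s t.
  by move=> _ _; exact: simple_closed_chord2.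
have [e [C [e0 C0 hG]]] := menger_density_bound alpha0 M0 fh gh reg simple hp.
pose dens tau := menger_density p (perturb f g tau)
  (perturb (fun i => derive1 (f i)) (fun i => derive1 (g i)) tau).
have degen tau x : in_period x.1.1 -> in_period x.1.2 -> in_period x.2 ->
    ~ separated x -> dens tau x.1.1 x.1.2 x.2 = 0.
  exact: (menger_density_degenerate fh gh hp).
pose P : set R := `[0, 2 * pi]%classic.
have inP s : P s -> in_period s by rewrite /P/= in_itv.
(* The integrand extended by 0 outside the cube of one period. *)
pose G tau (x : R * R * R) :=
  \1_P x.1.1 * (\1_P x.1.2 * (\1_P x.2 * dens tau x.1.1 x.1.2 x.2)).
have G_in tau x : P x.1.1 -> P x.1.2 -> P x.2 -> G tau x = dens tau x.1.1 x.1.2 x.2.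
  by move=> h1 h2 h3; rewrite /G !indicE !mem_set// !mul1r.
have G_out tau x : ~ (P x.1.1 /\ P x.1.2 /\ P x.2) -> G tau x = 0.
  move=> nP; have [h1|h1] := pselect (P x.1.1); last first.
    by rewrite /G indicE memNset// mul0r.
  have [h2|h2] := pselect (P x.1.2); last first.
    by rewrite /G [\1_P x.1.2]indicE memNset// mul0r mulr0.
  have [h3|h3] := pselect (P x.2); first by exfalso; apply: nP.
  by rewrite /G [\1_P x.2]indicE memNset// mul0r !mulr0.
(* Degeneracy of a triple does not depend on [tau], so on such triples the bounds and the
   differentiability in [tau] are trivial. *)
have G_deg tau x : ~ separated x -> G tau x = 0.
  move=> nx; have [[h1 [h2 h3]]|] := pselect (P x.1.1 /\ P x.1.2 /\ P x.2); last exact: G_out.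
  by rewrite G_in//; apply: degen => //; exact: inP.
pose mu := @lebesgue_measure R.
have energyE tau : menger_energy p (fun x : R => gamma x + tau *: Phi x) =
    (\int[mu]_s \int[mu]_t \int[mu]_u (G tau (s, t, u))%:E)%E.
  rewrite /menger_energy; apply: integral_setE => s Ps; last first.
    rewrite integral0_eq// => t _; rewrite integral0_eq// => u _.
    by rewrite G_out//= => -[].
  apply: integral_setE => t Pt; last first.
    by rewrite integral0_eq// => u _; rewrite G_out//= => -[_ []].
  apply: integral_setE => u Pu; last by rewrite G_out//= => -[_ [_]].
  rewrite G_in//; congr EFin.
  exact: (@perturb_curve_integrand R p tau gamma Phi s t u dgamma dPhi).
under eq_fun do rewrite energyE.
have [B B0 hB] := circ_kernel_integral b01.
pose k := circ_kernel b.
have k_ge0 x : 0 <= k x by exact: circ_kernel_ge0.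
(* The largest side of the triangle dominates both [s t] and [t u]. *)
have bound x : separated x ->
    circ_diam x.1.1 x.1.2 x.2 `^ ((alpha - 1) * p) <= k x.1 * k (x.1.2, x.2).
  move=> [hs ht hu [d12 d31 d23]].
  have lek s t : in_period s -> in_period t -> 0 < circ_dist s t ->
      circ_dist s t <= circ_diam x.1.1 x.1.2 x.2 ->
      circ_diam x.1.1 x.1.2 x.2 `^ (- b) <= k (s, t).
    move=> hs' ht' d0 dm.
    apply: (le_trans _ (circ_dist_powR_le_kernel b hs' ht' d0)).
    rewrite !powRN lef_pV2 ?posrE ?powR_gt0 ?(lt_le_trans d0 dm)//.
    by apply: ge0_ler_powR; rewrite ?nnegrE ?(ltW d0) ?(le_trans (ltW d0) dm)//; lra.
  have -> : (alpha - 1) * p = - b + - b by rewrite /b; field.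
  rewrite powRD; last first.
    by apply/implyP => _; rewrite gt_eqF// /circ_diam !lt_max d12.
  rewrite (surjective_pairing x.1); apply: ler_pM; rewrite ?powR_ge0//; apply: lek => //.
    by rewrite /circ_diam !le_max lexx.
  by rewrite /circ_diam !le_max lexx orbT.
apply: (@ederivable_triple_integral R _ (measurableTypeR R) mu G k P B C e e0 B0 C0).
- exact: measurable_itv.
- have : (lebesgue_measure (`[0%R, (2 * pi)%R]%classic : set R) < +oo)%E.
    by rewrite lebesgue_measure_itv/=; case: ifP => _; rewrite ?ltry// -EFinB ltry.
  exact.
- exact: measurable_circ_kernel.
- exact: k_ge0.
- exact: hB.
- move=> tau.
  have mP : measurable_fun setT (\1_P : measurableTypeR R -> R).
    by apply: measurable_indic; exact: measurable_itv.
  have m2 : measurable_fun setT (fun x : measurableTypeR R * measurableTypeR R *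
      measurableTypeR R => x.1.1).
    exact: (measurableT_comp measurable_fst measurable_fst).
  have m3 : measurable_fun setT (fun x : measurableTypeR R * measurableTypeR R *
      measurableTypeR R => x.1.2).
    exact: (measurableT_comp measurable_snd measurable_fst).
  have m4 : measurable_fun setT (fun x : measurableTypeR R * measurableTypeR R *
      measurableTypeR R => x.2) by exact: measurable_snd.
  apply: measurable_funM; first exact: (measurableT_comp mP m2).
  apply: measurable_funM; first exact: (measurableT_comp mP m3).
  apply: measurable_funM; first exact: (measurableT_comp mP m4).
  have mpert (h h' : 'I_3 -> R -> R) i : continuous (h i) -> continuous (h' i) ->
      measurable_fun setT (perturb h h' tau i).
    move=> ch ch'; apply: measurable_funD; first exact: continuous_measurable_fun.
    by apply: measurable_funM => //; exact: continuous_measurable_fun.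
  have chold h : hoelder1 alpha M h -> continuous h.
    move=> [_ dh _ _ _] x.
    by apply: differentiable_continuous; exact/derivable1_diffP.
  apply: measurable_menger_density => // i; apply: mpert; try exact: chold.
    by have [_ _ cf _ _] := fh i; exact: cf.
  by have [_ _ cg _ _] := gh i; exact: cg.
- move=> tau x; rewrite /G !mulr_ge0// ?powR_ge0//.
- move=> tau x te; have [sx|nx] := pselect (separated x); last first.
    by rewrite G_deg// normr0 !mulr_ge0.
  have [h1|h1] := pselect (P x.1.1 /\ P x.1.2 /\ P x.2); last first.
    by rewrite G_out// normr0 !mulr_ge0.
  have [h2 [h3 h4]] := h1; have [+ _] := hG tau x te sx; rewrite G_in// => /le_trans; apply.
  by apply: ler_wpM2l => //; exact: bound.
- move=> tau x te; have [sx|nx] := pselect (separated x); last first.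
    by rewrite !G_deg// subrr normr0 !mulr_ge0.
  have [h1|h1] := pselect (P x.1.1 /\ P x.1.2 /\ P x.2); last first.
    by rewrite !G_out// subrr normr0 !mulr_ge0.
  have [h2 [h3 h4]] := h1; have [_ +] := hG tau x te sx; rewrite !G_in// => /le_trans; apply.
  by do 2 apply: ler_wpM2l => //; exact: bound.
- move=> x; have [sx|nx] := pselect (separated x); last first.
    rewrite (_ : G ^~ x = cst 0); first exact: derivable_cst.
    by apply/funext => tau; exact: G_deg.
  do 3 (apply: derivable_mulf; first exact: derivable_cst).
  exact: (derivable_menger_density reg simple hp sx).
Qed.
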